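(* Assume $0\in\mathbb{T}$ and let $A\in\mathcal{R}(\mathbb{T},\mathbb{H}^{n\times n})$ be a constant quaternion matrix. If $A$ has $n$ right linearly independent eigenvectors $\eta_1,\dots,\eta_n$ corresponding to right eigenvalues $\lambda_1,\dots,\lambda_n$ (no matter whether these are similar), then $$M(t)=\left(\eta_1E_{\lambda_1}(t,0),\ \eta_2E_{\lambda_2}(t,0),\ \dots,\ \eta_nE_{\lambda_n}(t,0)\right)$$ is a fundamental solution matrix of $\phi^\Delta(t)=A\phi(t)$. In particular, if $A$ has $n$ distinct standard eigenvalues, then $\lambda_1,\dots,\lambda_n$ can be chosen to be the standard eigenvalues of $A$.
   Context: A time scale $\mathbb{T}$ is a nonempty closed subset of $\mathbb{R}$. For $t\in\mathbb{T}$: $\sigma(t)=\inf\{s\in\mathbb{T}:s>t\}$, $\rho(t)=\sup\{s\in\mathbb{T}:s<t\}$ (with $\inf\emptyset=\sup\mathbb{T}$, $\sup\emptyset=\inf\mathbb{T}$), $\mu(t)=\sigma(t)-t$. $\mathbb{T}^\kappa=\mathbb{T}\setminus(\rho(\sup\mathbb{T}),\sup\mathbb{T}]$ if $\sup\mathbb{T}<\infty$, and $\mathbb{T}^\kappa=\mathbb{T}$ otherwise. $\mathbb{H}$ is the skew field of quaternions with units $i,j,k$. A function $f:\mathbb{T}\to\mathbb{H}$ has delta derivative $f^\Delta(t)$ at $t\in\mathbb{T}^\kappa$ if for every $\varepsilon>0$ there is $\delta>0$ with $|f(\sigma(t))-f(s)-f^\Delta(t)(\sigma(t)-s)|\le\varepsilon|\sigma(t)-s|$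 for all $s\in(t-\delta,t+\delta)\cap\mathbb{T}$; for vectors and matrices this is entrywise. $\int_r^s f(t)\Delta t=F(s)-F(r)$, where $F^\Delta=f$ on $\mathbb{T}^\kappa$. A constant matrix $A$ belongs to $\mathcal{R}(\mathbb{T},\mathbb{H}^{n\times n})$ if $I_n+\mu(t)A$ is invertible for all $t\in\mathbb{T}^\kappa$. A nonzero $\eta\in\mathbb{H}^{n}$ is a (right) eigenvector of $A$ for the right eigenvalue $\lambda\in\mathbb{H}$ if $A\eta=\eta\lambda$. The standard eigenvalues of $A$ are its right eigenvalues that are complex numbers (in $\mathbb{R}+\mathbb{R}i$) with nonnegative imaginary part (there are exactly $n$ of them, counted with multiplicity). Quaternions $p,q$ are similar if $p=\alpha^{-1}q\alpha$ for some nonzero $\alpha\in\mathbb{H}$. Vectors $\eta_1,\dots,\eta_n\in\mathbb{H}^n$ are right linearly independent if $\eta_1\alpha_1+\dots+\eta_n\alpha_n=0$, $\alpha_i\in\mathbb{H}$, implies all $\alpha_i=0$; functions $x_1,\dots,x_n:\mathbb{T}\to\mathbb{H}^n$ are right linearly independent on $\mathbb{T}$ if $\sum_i x_i(t)\alpha_i=0$ for all $t\in\mathbb{T}$, with $\alpha_i\in\mathbb{H}$, implies all $\alpha_i=0$. A solution of $\phi^\Delta=A\phi$ is a delta differentiable $\phi:\mathbb{T}\to\mathbb{H}^n$ satisfying the equation at every $t\in\mathbb{T}^\kappa$; a fundamental solution matrix is an $n\times n$ matrix function whose columns are $n$ right linearly independent solutions. For $q\in\mathbb{H}$ with scalar part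 $\Re(q)$ and vector part $\Im(q)$: $\exp(q)=\sum_{n\ge0}q^n/n!$; for $q\ne0$, $\mathrm{Ln}(q)=\ln|q|+\frac{\Im(q)}{|\Im(q)|}\arccos\frac{\Re(q)}{|q|}$ if $q\notin\mathbb{R}$, and $\mathrm{Ln}(q)=\ln|q|+i\pi\frac{1-\mathrm{sgn}(q)}{2}$ if $q\in\mathbb{R}$. $\xi_h(q)=\frac1h\mathrm{Ln}(1+qh)$ for $h>0$, $\xi_0(q)=q$. For a constant $\lambda\in\mathbb{H}$ with $1+\mu(t)\lambda\ne0$ on $\mathbb{T}^\kappa$, $E_\lambda(t,s)=\exp\left(\int_s^t\xi_{\mu(\tau)}(\lambda)\Delta\tau\right)$. *)

(* Defs.v *)
From HB Require Import structures.
From mathcomp Require Import all_boot all_order all_algebra.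
From mathcomp Require Import ring lra.
From mathcomp Require Import all_classical all_reals all_analysis.

Set Implicit Arguments.
Unset Strict Implicit.
Unset Printing Implicit Defensive.

Import Order.TTheory GRing.Theory Num.Theory.
Import numFieldNormedType.Exports.

Local Open Scope classical_set_scope.
Local Open Scope ring_scope.

(* [Quat a b c d] is a + b i + c j + d k. *)
Record quat (R : realType) := Quat { qre : R; qi : R; qj : R; qk : R }.

Section QuatStructures.
Variable R : realType.
Implicit Types p q r : quat R.

Definition quat_tuple q : R * R * R * R := (qre q, qi q, qj q, qk q).
Definition tuple_quat (x : R * R * R * R) : quat R :=
  let: (a, b, c, d) := x in Quat a b c d.

Lemma quat_tupleK : cancel quat_tuple tuple_quat.
Proof. by case. Qed.

HB.instance Definition _ := Choice.copy (quat R) (can_type quat_tupleK).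

Lemma quatP p q :
  qre p = qre q -> qi p = qi q -> qj p = qj q -> qk p = qk q -> p = q.
Proof. by case: p => a b c d; case: q => a' b' c' d' /= -> -> -> ->. Qed.

Definition quat0 : quat R := Quat 0 0 0 0.
Definition addq p q : quat R :=
  Quat (qre p + qre q) (qi p + qi q) (qj p + qj q) (qk p + qk q).
Definition oppq p : quat R := Quat (- qre p) (- qi p) (- qj p) (- qk p).

Lemma addqA : associative addq.
Proof. by move=> p q r; apply: quatP => /=; rewrite addrA. Qed.
Lemma addqC : commutative addq.
Proof. by move=> p q; apply: quatP => /=; rewrite addrC. Qed.
Lemma add0q : left_id quat0 addq.
Proof. by move=> p; apply: quatP => /=; rewrite add0r. Qed.
Lemma addNq : left_inverse quat0 oppq addq.
Proof. by move=> p; apply: quatP => /=; rewrite addNr. Qed.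

HB.instance Definition _ :=
  GRing.isZmodule.Build (quat R) addqA addqC add0q addNq.

Definition quat1 : quat R := Quat 1 0 0 0.
Definition mulq p q : quat R :=
  Quat (qre p * qre q - qi p * qi q - qj p * qj q - qk p * qk q)
       (qre p * qi q + qi p * qre q + qj p * qk q - qk p * qj q)
       (qre p * qj q - qi p * qk q + qj p * qre q + qk p * qi q)
       (qre p * qk q + qi p * qj q - qj p * qi q + qk p * qre q).

Lemma mulqA : associative mulq.
Proof. by move=> p q r; apply: quatP => /=; ring. Qed.
Lemma mul1q : left_id quat1 mulq.
Proof. by move=> p; apply: quatP => /=; ring. Qed.
Lemma mulq1 : right_id quat1 mulq.
Proof. by move=> p; apply: quatP => /=; ring. Qed.
Lemma mulqDl : left_distributive mulq +%R.
Proof. by move=> p q r; apply: quatP => /=; ring. Qed.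
Lemma mulqDr : right_distributive mulq +%R.
Proof. by move=> p q r; apply: quatP => /=; ring. Qed.
Lemma oneq_neq0 : quat1 != 0.
Proof. by apply/eqP => -[/eqP]; rewrite oner_eq0. Qed.

HB.instance Definition _ := GRing.Zmodule_isNzRing.Build (quat R)
  mulqA mul1q mulq1 mulqDl mulqDr oneq_neq0.

Definition scaleq (a : R) q : quat R :=
  Quat (a * qre q) (a * qi q) (a * qj q) (a * qk q).

Lemma scaleqA a b q : scaleq a (scaleq b q) = scaleq (a * b) q.
Proof. by apply: quatP => /=; rewrite mulrA. Qed.
Lemma scale1q : left_id 1 scaleq.
Proof. by move=> q; apply: quatP => /=; rewrite mul1r. Qed.
Lemma scaleqDr : right_distributive scaleq +%R.
Proof. by move=> a p q; apply: quatP => /=; rewrite mulrDr. Qed.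
Lemma scaleqDl q : {morph scaleq^~ q : a b / a + b}.
Proof. by move=> a b; apply: quatP => /=; rewrite mulrDl. Qed.

HB.instance Definition _ := GRing.Zmodule_isLmodule.Build R (quat R)
  scaleqA scale1q scaleqDr scaleqDl.

Lemma scaleqAl (a : R) p q : a *: (p * q) = (a *: p) * q.
Proof. by apply: quatP => /=; ring. Qed.
HB.instance Definition _ := GRing.Lmodule_isLalgebra.Build R (quat R) scaleqAl.

Lemma scaleqAr (a : R) p q : a *: (p * q) = p * (a *: q).
Proof. by apply: quatP => /=; ring. Qed.
HB.instance Definition _ := GRing.Lalgebra_isAlgebra.Build R (quat R) scaleqAr.

Definition sqnormq q : R := qre q ^+ 2 + qi q ^+ 2 + qj q ^+ 2 + qk q ^+ 2.
Definition normq q : R := Num.sqrt (sqnormq q).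

Lemma sqnormq_ge0 q : 0 <= sqnormq q.
Proof. by rewrite /sqnormq !addr_ge0 // sqr_ge0. Qed.

Lemma sqnormq_eq0 q : sqnormq q = 0 -> q = 0.
Proof.
rewrite /sqnormq => /eqP.
rewrite !paddr_eq0 ?addr_ge0 ?sqr_ge0 // !sqrf_eq0.
by case/andP => /andP[/andP[/eqP ? /eqP ?] /eqP ?] /eqP ?; apply: quatP.
Qed.

Lemma normq_eq0 q : normq q = 0 -> q = 0.
Proof.
move/eqP; rewrite sqrtr_eq0 => q0; apply: sqnormq_eq0.
by apply/eqP; rewrite eq_le q0 sqnormq_ge0.
Qed.

Lemma normqZ (a : R) q : normq (a *: q) = `|a| * normq q.
Proof.
rewrite /normq -sqrtr_sqr -sqrtrM ?sqr_ge0 //; congr Num.sqrt.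
by rewrite /sqnormq /=; ring.
Qed.

Lemma ler_normqD p q : normq (p + q) <= normq p + normq q.
Proof.
have np : 0 <= normq p by exact: sqrtr_ge0.
have nq : 0 <= normq q by exact: sqrtr_ge0.
have sp : normq p ^+ 2 = sqnormq p by rewrite sqr_sqrtr // sqnormq_ge0.
have sq : normq q ^+ 2 = sqnormq q by rewrite sqr_sqrtr // sqnormq_ge0.
pose d := qre p * qre q + qi p * qi q + qj p * qj q + qk p * qk q.
have cs : d <= normq p * normq q.
  apply: le_trans (ler_norm d) _.
  rewrite -ler_sqr ?nnegrE ?mulr_ge0 // exprMn sp sq real_normK ?num_real //.
  rewrite -subr_ge0.
  have -> : sqnormq p * sqnormq q - d ^+ 2 =
      (qre p * qi q - qi p * qre q) ^+ 2 + (qre p * qj q - qj p * qre q) ^+ 2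
    + (qre p * qk q - qk p * qre q) ^+ 2 + (qi p * qj q - qj p * qi q) ^+ 2
    + (qi p * qk q - qk p * qi q) ^+ 2 + (qj p * qk q - qk p * qj q) ^+ 2.
    by rewrite /sqnormq /d; ring.
  by rewrite !addr_ge0 // sqr_ge0.
rewrite -ler_sqr ?nnegrE ?addr_ge0 ?sqrtr_ge0 //.
rewrite sqr_sqrtr ?sqnormq_ge0 // sqrrD sp sq.
have -> : sqnormq (p + q) = sqnormq p + d *+ 2 + sqnormq q.
  by rewrite /sqnormq /d /=; ring.
by rewrite lerD2r lerD2l lerMn2r.
Qed.

HB.instance Definition _ := Lmodule_isNormed.Build R (quat R)
  ler_normqD normqZ normq_eq0.

Definition conjq q : quat R := Quat (qre q) (- qi q) (- qj q) (- qk q).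
Definition invq q : quat R := (sqnormq q)^-1 *: conjq q.

Lemma sqnormq_neq0 q : q != 0 -> sqnormq q != 0.
Proof. by apply: contra => /eqP/sqnormq_eq0 ->. Qed.

Lemma mulVq : {in [pred q | q != 0], left_inverse 1 invq *%R}.
Proof.
move=> q; rewrite inE => /sqnormq_neq0 q0.
rewrite /invq -scalerAl -[RHS](scale1r 1) -(mulVf q0) -scalerA; congr (_ *: _).
by apply: quatP; rewrite /sqnormq /=; ring.
Qed.

Lemma mulqV : {in [pred q | q != 0], right_inverse 1 invq *%R}.
Proof.
move=> q; rewrite inE => /sqnormq_neq0 q0.
rewrite /invq -scalerAr -[RHS](scale1r 1) -(mulVf q0) -scalerA; congr (_ *: _).
by apply: quatP; rewrite /sqnormq /=; ring.
Qed.

Lemma quat_unitP p q : q * p = 1 /\ p * q = 1 -> p != 0.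
Proof.
case=> qp1 _; apply/eqP => p0; move: qp1; rewrite p0 mulr0 => /esym/eqP.
by rewrite oner_eq0.
Qed.

Lemma invq_out : {in [predC [pred q | q != 0]], invq =1 id}.
Proof.
move=> q; rewrite !inE negbK => /eqP ->.
by apply: quatP; rewrite /= ?oppr0 mulr0.
Qed.

HB.instance Definition _ :=
  GRing.NzRing_hasMulInverse.Build (quat R) mulVq mulqV quat_unitP invq_out.

End QuatStructures.

Section QuatFunctions.
Variable R : realType.

Definition qvec (q : quat R) : quat R := Quat 0 (qi q) (qj q) (qk q).

Definition qreal (a : R) : quat R := Quat a 0 0 0.
Definition qI : quat R := Quat 0 1 0 0.

Definition qexp (q : quat R) : quat R :=
  limn (series (fun k : nat => (k`!%:R : R)^-1 *: q ^+ k)).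

(* Principal logarithm, meaningful for [q != 0] only; on negative reals the
   argument is pi, along the unit i. *)
Definition qLn (q : quat R) : quat R :=
  if qvec q == 0
  then qreal (ln `|q|) + (pi * ((1 - Num.sg (qre q)) / 2)) *: qI
  else qreal (ln `|q|) + (acos (qre q / `|q|) / `|qvec q|) *: qvec q.

(* The map xi_h, meaningful for [0 <= h] only. *)
Definition cylinder (h : R) (q : quat R) : quat R :=
  if h == 0 then q else h^-1 *: qLn (1 + h *: q).

End QuatFunctions.

(* A function on a time scale [T] is represented by a function on [R], of which
   only the values on [T] are ever used. *)

Section TimeScales.
Variable R : realType.
Implicit Types (T : set R) (t s : R).

Definition time_scale T := T !=set0 /\ closed T.

(* [inf] and [sup] are only meaningful on nonempty bounded sets, hence the case
   distinctions implementing the conventions inf set0 = sup T and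
   sup set0 = inf T; for [t] in [T] these cases occur only when [t] is the
   greatest, respectively the least, element of [T]. *)
Definition sigma T t : R :=
  if `[< [set s | T s /\ t < s] !=set0 >]
  then inf [set s | T s /\ t < s] else sup T.

Definition rho T t : R :=
  if `[< [set s | T s /\ s < t] !=set0 >]
  then sup [set s | T s /\ s < t] else inf T.

Definition mu T t : R := sigma T t - t.

Definition kappa T : set R :=
  if `[< has_ubound T >] then T `\` [set t | rho T (sup T) < t <= sup T]
  else T.

Definition is_delta_derivative T (f : R -> quat R) t (d : quat R) :=
  forall e : R, 0 < e -> exists2 delta : R, 0 < delta &
    forall s, T s -> t - delta < s < t + delta ->
      `|f (sigma T t) - f s - (sigma T t - s) *: d| <= e * `|sigma T t - s|.

Definition is_delta_antiderivative T (F f : R -> quat R) :=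
  forall t, kappa T t -> is_delta_derivative T F t (f t).

(* The value at [s] minus the value at [r] of an antiderivative of [f] (this
   does not depend on the antiderivative), and 0 if [f] has none. *)
Definition delta_integral T (f : R -> quat R) (r s : R) : quat R :=
  xget 0 [set v | exists F, is_delta_antiderivative T F f /\ v = F s - F r].

Definition delta_exp T (lambda : quat R) (t s : R) : quat R :=
  qexp (delta_integral T (fun tau => cylinder (mu T tau) lambda) s t).

End TimeScales.

Section QuatLinearAlgebra.
Variables (R : realType) (n : nat).
Implicit Types (T : set R) (A : 'M[quat R]_n) (v : 'cV[quat R]_n).

Definition rscale v (a : quat R) : 'cV[quat R]_n := \col_i (v i 0 * a).

Definition quat_invertible A :=
  exists B : 'M[quat R]_n, A *m B = 1%:M /\ B *m A = 1%:M.

Definition regressive T A :=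
  forall t, kappa T t -> quat_invertible (1%:M + qreal (mu T t) *: A).

Definition right_eigenvector A (lambda : quat R) v :=
  v != 0 /\ A *m v = rscale v lambda.

Definition right_eigenvalue A (lambda : quat R) :=
  exists v, right_eigenvector A lambda v.

Definition standard_eigenvalues A : set (quat R) :=
  [set lambda | right_eigenvalue A lambda /\
                [/\ 0 <= qi lambda, qj lambda = 0 & qk lambda = 0]].

Definition right_independent (m : nat) (eta : 'I_m -> 'cV[quat R]_n) :=
  forall a : 'I_m -> quat R,
    \sum_i rscale (eta i) (a i) = 0 -> forall i, a i = 0.

Definition right_independent_on T (m : nat) (x : 'I_m -> R -> 'cV[quat R]_n) :=
  forall a : 'I_m -> quat R,
    (forall t, T t -> \sum_i rscale (x i t) (a i) = 0) -> forall i, a i = 0.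

Definition is_solution T A (phi : R -> 'cV[quat R]_n) :=
  forall t, kappa T t -> forall i : 'I_n,
    is_delta_derivative T (fun s => phi s i 0) t ((A *m phi t) i 0).

Definition fundamental_solution_matrix T A (M : R -> 'M[quat R]_n) :=
  (forall j, is_solution T A (fun t => col j (M t))) /\
  right_independent_on T (fun j t => col j (M t)).

Definition exp_eigen_matrix T (lambda : 'I_n -> quat R)
    (eta : 'I_n -> 'cV[quat R]_n) (t : R) : 'M[quat R]_n :=
  \matrix_(i, j) rscale (eta j) (delta_exp T (lambda j) t 0) i 0.

End QuatLinearAlgebra.

(* Main.v *)
(* For a fixed exponent l, all values xi_h(l) lie in one complex plane R + R u,
   u^2 = -1, where exp is the complex exponential e^a (cos b + u sin b); this
   also covers negative 1 + h l, for which u = i.  So all exponentials involved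
   commute, and E_l^Delta = l E_l reduces to exp(Ln q) = q at right-scattered
   points and to exp z = 1 + z + o(|z|) at right-dense ones; then A eta = eta l
   makes eta E_l a solution.
   The integral defining E_l exists because xi_h(l) -> l as h -> 0: on each gap
   (t, sigma t) put the constant xi_{mu(t)}(l), on T put l, and take the Lebesgue
   primitive of this function.  It is unique by induction on the time scale.
   For the standard eigenvalues, eigenvectors of pairwise non-similar right
   eigenvalues are independent, similar standard eigenvalues are equal, and
   n + 1 vectors of H^n are dependent. *)
Require Import Defs.
From mathcomp Require Import all_boot all_order all_algebra.
From mathcomp Require Import ring lra.
From mathcomp Require Import all_classical all_reals all_analysis.
From mathcomp Require Import measurable_realfun.

Set Implicit Arguments.
Unset Strict Implicit.
Unset Printing Implicit Defensive.

Import Order.TTheory GRing.Theory Num.Theory.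
Import numFieldNormedType.Exports.

Local Open Scope classical_set_scope.
Local Open Scope ring_scope.

(** * Jump operators, the set [kappa T], induction on a time scale, and uniqueness of delta
    antiderivatives *)

Section TimeScaleFacts.
Variables (R : realType) (T : set R).
Hypothesis hT : time_scale T.
Implicit Types (a b c s t e : R).

Lemma closed_set_sup (S : set R) : S `<=` T -> S !=set0 -> has_ubound S -> T (sup S).
Proof.
move=> ST S0 uS; have [_ cT] := hT.
by apply: cT; apply: closure_subset (closure_sup S0 uS).
Qed.

Lemma closed_set_inf (S : set R) : S `<=` T -> S !=set0 -> has_lbound S -> T (inf S).
Proof.
move=> ST S0 lS; have [_ cT] := hT.
apply: cT => B /nbhs_ballP[e /= e0 Be]; have [x Sx xe] := inf_adherent e0 (conj S0 lS).
exists x; split; first exact: ST.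
apply: Be; rewrite /ball /= ltr_norml; have := ge_inf lS Sx; lra.
Qed.

Lemma sigma_max t : T t -> ~ ([set s | T s /\ t < s] !=set0) -> sigma T t = t.
Proof.
move=> Tt; rewrite /sigma; case: asboolP => // n0 _.
have ub : ubound T t.
  by move=> s Ts; rewrite leNgt; apply/negP => ts; apply: n0; exists s.
apply/eqP; rewrite eq_le; apply/andP; split.
  by apply: ge_sup => //; exists t.
by apply: ub_le_sup => //; exists t.
Qed.

Let has_lb t : has_lbound [set s | T s /\ t < s].
Proof. by exists t => s [_ /ltW]. Qed.

Lemma sigma_le t s : T s -> t < s -> sigma T t <= s.
Proof.
move=> Ts ts; rewrite /sigma; case: asboolP => [n0|[]]; last by exists s.
exact: ge_inf.
Qed.

Lemma le_sigma t : T t -> t <= sigma T t.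
Proof.
move=> Tt; case: (pselect ([set s | T s /\ t < s] !=set0)) => n0; last first.
  by rewrite sigma_max.
rewrite /sigma asboolT //; apply: lb_le_inf => // s [_ /ltW] //.
Qed.

Lemma sigma_in t : T t -> T (sigma T t).
Proof.
move=> Tt; case: (pselect ([set s | T s /\ t < s] !=set0)) => n0; last first.
  by rewrite sigma_max.
rewrite /sigma asboolT //; apply: closed_set_inf => // s [] //.
Qed.

Lemma mu_ge0 t : T t -> 0 <= mu T t.
Proof. by move=> Tt; rewrite /mu subr_ge0 le_sigma. Qed.

Lemma right_dense_approx t s e : sigma T t = t -> T s -> t < s -> 0 < e ->
  exists2 r, T r /\ t < r & r < t + e.
Proof.
move=> st Ts ts e0; have n0 : [set s | T s /\ t < s] !=set0 by exists s.
move: st; rewrite /sigma asboolT // => st.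
have [r [Tr tr] rlt] := inf_adherent e0 (conj n0 (has_lb t)).
by exists r => //; rewrite -{1}st.
Qed.

Lemma kappa_sub t : kappa T t -> T t.
Proof. by rewrite /kappa; case: asboolP => // _ []. Qed.

(** The point [t] is itself one of the points of [T] below [sup T], so [rho T (sup T)] cannot be
    smaller than [t]. *)
Lemma kappa_lt t s : T t -> T s -> t < s -> kappa T t.
Proof.
move=> Tt Ts ts; rewrite /kappa; case: asboolP => // ub; split=> //= /andP[+ _].
apply/negP; rewrite -leNgt.
have tM : t < sup T by apply: lt_le_trans ts _; exact: ub_le_sup.
rewrite /rho asboolT; last by exists t.
by apply: ub_le_sup => //; exists (sup T) => r [_ /ltW].
Qed.

(** Only a left-scattered maximum is removed from [T]: if [t] is the maximum, left density forces
    [rho T t] to be at least [t]. *)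
Lemma kappa_left_dense t : T t ->
  (forall e, 0 < e -> exists2 s, T s & t - e < s < t) -> kappa T t.
Proof.
move=> Tt ld; case: (pselect (exists2 s, T s & t < s)) => [[s Ts ts]|mx].
  exact: kappa_lt ts.
have ub : ubound T t.
  by move=> s Ts; rewrite leNgt; apply/negP => ts; apply: mx; exists s.
have supE : sup T = t.
  apply/eqP; rewrite eq_le ge_sup ?ub_le_sup //; first by exists t.
  by exists t.
rewrite /kappa asboolT; last by exists t.
split=> //=; rewrite supE => /andP[+ _]; apply/negP; rewrite -leNgt.
have [s1 Ts1 /andP[_ s1t]] := ld _ (@ltr01 R).
rewrite /rho asboolT; last by exists s1.
apply/ler_addgt0Pl => e e0; have [s Ts /andP[se st]] := ld _ e0.
rewrite -lerBlDl (le_trans (ltW se)) //; apply: ub_le_sup => //.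
by exists t => r [_ /ltW].
Qed.

(** Let [c] be the supremum of the points [t <= b] of [T] such that [P] holds on all of [T] between
    [a] and [t]. The left-dense clause gives [P c]; if [c < b], the jump clause or the right-dense
    clause carries [P] beyond [c], a contradiction. The dense clauses provide [kappa T t] because
    derivatives are known only there. *)
Lemma time_scale_ind (P : R -> Prop) a :
  T a -> P a ->
  (forall t, T t -> a <= t -> t < sigma T t -> P t -> P (sigma T t)) ->
  (forall t, T t -> a <= t -> sigma T t = t -> kappa T t -> P t ->
     exists2 d, 0 < d & forall s, T s -> t < s < t + d -> P s) ->
  (forall t, T t -> a < t -> kappa T t ->
     (forall e, 0 < e -> exists2 s, T s & t - e < s < t) ->
     (forall s, T s -> a <= s < t -> P s) -> P t) ->
  forall t, T t -> a <= t -> P t.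
Proof.
move=> Ta Pa Hs Hr Hl b Tb ab.
pose S := [set t | [/\ T t, a <= t <= b & forall r, T r -> a <= r <= t -> P r]].
have Sa : S a.
  by split=> //; [rewrite lexx | move=> r _ ar; rewrite (_ : r = a) //; lra].
have S0 : S !=set0 by exists a.
have uS : has_ubound S by exists b => t [_ /andP[_]].
pose c := sup S.
have Tc : T c by apply: closed_set_sup => // t [].
have ac : a <= c by apply: ub_le_sup.
have cb : c <= b by apply: ge_sup => // t [_ /andP[_]].
have below r : T r -> a <= r < c -> P r.
  move=> Tr /andP[ar rc].
  have [|t [Tt _ Pt] rt] := @sup_adherent _ S (c - r) _ (conj S0 uS).
    by rewrite subr_gt0.
  by apply: Pt => //; move: rt; rewrite -/c; lra.
(* If [c] were not in [S], the points of [S] approaching it would lie strictly below it, so [c]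
   would be left-dense and the last clause would apply. *)
have Sc : S c.
  have [//|nSc] := pselect (S c).
  have ac' : a < c.
    by rewrite lt_neqAle ac andbT; apply/eqP => E; apply: nSc; rewrite -E.
  have ld e : 0 < e -> exists2 s, T s & c - e < s < c.
    move=> e0; have [t St et] := sup_adherent e0 (conj S0 uS).
    exists t; first by case: St.
    rewrite et lt_neqAle (ub_le_sup uS St) andbT /=.
    by apply/eqP => E; apply: nSc; rewrite -[c]E.
  have Pc : P c by apply: Hl => //; exact: kappa_left_dense.
  split=> //; first by rewrite ac.
  move=> r Tr /andP[ar]; rewrite le_eqVlt => /orP[/eqP -> //|rc].
  by apply: below => //; rewrite ar.
have [_ _ Pc] := Sc.
have Pcc : P c by apply: Pc => //; rewrite ac lexx.
case: (ltP c b) => [ltcb|bc]; last first.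
  by rewrite (_ : b = c) //; apply/eqP; rewrite eq_le cb bc.
have kc : kappa T c by exact: kappa_lt ltcb.
have := le_sigma Tc; rewrite le_eqVlt => /orP[/eqP/esym sc|sc].
  have [d d0 Pd] := Hr _ Tc ac sc kc Pcc.
  have [|r [Tr cr] rlt] := @right_dense_approx c b (Num.min d (b - c)) sc Tb ltcb.
    by rewrite lt_min d0 subr_gt0.
  suff Sr : S r by have := ub_le_sup uS Sr; rewrite -/c; lra.
  have rd : r < c + d by apply: lt_le_trans rlt _; rewrite lerD2l ge_min lexx.
  have rb : r < b.
    have : Num.min d (b - c) <= b - c by rewrite ge_min lexx orbT.
    by move: rlt; lra.
  split=> //; first by apply/andP; split; lra.
  move=> q Tq /andP[aq qr]; case: (leP q c) => qc; first by apply: Pc; rewrite ?aq.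
  by apply: Pd => //; lra.
have Ts := sigma_in Tc; have sb := sigma_le Tb ltcb.
have Psc : P (sigma T c) by apply: Hs.
suff : S (sigma T c) by move=> Ss; have := ub_le_sup uS Ss; rewrite -/c; lra.
split=> //; first by apply/andP; split; lra.
move=> q Tq /andP[aq qs]; case: (leP q c) => qc; first by apply: Pc; rewrite ?aq.
by rewrite (_ : q = sigma T c) //; apply/eqP; rewrite eq_le qs sigma_le.
Qed.

Lemma is_delta_derivativeB (f g : R -> quat R) t p q :
  is_delta_derivative T f t p -> is_delta_derivative T g t q ->
  is_delta_derivative T (f \- g) t (p - q).
Proof.
move=> Df Dg e e0; have e20 : 0 < e / 2 by rewrite divr_gt0.
have [d1 d10 H1] := Df _ e20; have [d2 d20 H2] := Dg _ e20.
exists (Num.min d1 d2); first by rewrite lt_min d10.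
move=> s Ts sd.
have m1 : Num.min d1 d2 <= d1 by rewrite ge_min lexx.
have m2 : Num.min d1 d2 <= d2 by rewrite ge_min lexx orbT.
have {}H1 : `|f (sigma T t) - f s - (sigma T t - s) *: p| <= e / 2 * `|sigma T t - s|.
  by apply: H1 => //; lra.
have {}H2 : `|g (sigma T t) - g s - (sigma T t - s) *: q| <= e / 2 * `|sigma T t - s|.
  by apply: H2 => //; lra.
rewrite scalerBr /=.
rewrite (_ : (f (sigma T t) - g (sigma T t) - (f s - g s)
    - ((sigma T t - s) *: p - (sigma T t - s) *: q)) = (f (sigma T t) - f s - (sigma T t - s) *: p)
                   - (g (sigma T t) - g s - (sigma T t - s) *: q)); last first.
  by apply: quatP => /=; ring.
apply: le_trans (ler_normB _ _) _; rewrite [e]splitr mulrDl.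
exact: lerD.
Qed.

(** The choice [s = t] in the definition bounds the difference by [e * mu T t] for every positive
    [e]. *)
Lemma is_delta_derivative_jump (f : R -> quat R) t d : T t ->
  is_delta_derivative T f t d -> f (sigma T t) = f t + mu T t *: d.
Proof.
move=> Tt Df; apply/eqP; rewrite -subr_eq0 opprD addrA -normr_le0.
apply/ler_addgt0Pl => e e0; rewrite addr0; pose e' := e / (mu T t + 1).
have mu1 : 0 < mu T t + 1 by have := mu_ge0 Tt; lra.
have [|dl dl0 H] := Df e'; first by rewrite divr_gt0.
have /(H _ Tt) : t - dl < t < t + dl by lra.
move=> /le_trans; apply; rewrite ger0_norm ?mu_ge0 // /e' mulrAC -mulrA.
rewrite ler_piMr ?(ltW e0) // ler_pdivrMr // mul1r /mu; lra.
Qed.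

(** For every slope [e' > 0], time scale induction shows that [D] moves by at most [e' * (t - a)]
    between [a] and [t]. Across a gap a function with zero derivative does not change at all. *)
Lemma delta_derivative0_const (D : R -> quat R) :
  (forall t, kappa T t -> is_delta_derivative T D t 0) ->
  forall a b, T a -> T b -> a <= b -> D b = D a.
Proof.
move=> D0 a b Ta Tb ab; apply/eqP; rewrite -subr_eq0 -normr_le0.
apply/ler_addgt0Pl => e e0; rewrite addr0; pose e' := e / (b - a + 1).
have ba1 : 0 < b - a + 1 by lra.
have e'0 : 0 < e' by rewrite divr_gt0.
suff H t : T t -> a <= t -> `|D t - D a| <= e' * (t - a).
  apply: le_trans (H _ Tb ab) _; rewrite /e' mulrAC -mulrA.
  rewrite ler_piMr ?(ltW e0) // ler_pdivrMr // mul1r; lra.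
have jump s : kappa T s -> D (sigma T s) = D s.
  by move=> ks; rewrite (is_delta_derivative_jump (kappa_sub ks) (D0 _ ks)) scaler0 addr0.
have small s r : kappa T s -> 0 < r -> exists2 dl, 0 < dl & forall u, T u ->
    s - dl < u < s + dl -> `|D s - D u| <= r * `|sigma T s - u|.
  move=> ks r0; have [dl dl0 H] := D0 _ ks _ r0; exists dl => // u Tu us.
  by have := H _ Tu us; rewrite scaler0 subr0 jump.
move=> Tt at_; move: t Tt at_.
apply: (@time_scale_ind (fun t => `|D t - D a| <= e' * (t - a))) => //.
- by rewrite !subrr normr0 mulr0.
- move=> t Tt at_ ts Pt; rewrite jump; last exact: kappa_lt (sigma_in Tt) ts.
  by apply: le_trans Pt _; rewrite ler_pM2l // lerD2r ltW.
- move=> t Tt at_ st kt Pt; have [dl dl0 H] := small _ _ kt e'0.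
  exists dl => // s Ts /andP[ts sd].
  have {}H : `|D t - D s| <= e' * (s - t).
    have : `|D t - D s| <= e' * `|sigma T t - s| by apply: H => //; lra.
    by rewrite st (distrC t s) (@ger0_norm _ (s - t)) //; lra.
  rewrite (_ : D s - D a = (D t - D a) - (D t - D s)); last first.
    by apply: quatP => /=; ring.
  apply: le_trans (ler_normB _ _) _.
  rewrite (_ : s - a = (t - a) + (s - t)); last by lra.
  by rewrite mulrDr lerD.
- move=> t Tt at_ kt ld Pt; apply/ler_addgt0Pl => r r0.
  (* The definition measures distances from [sigma T t], not from [t]. As [s] will be at least [a],
     they are at most [sigma T t - a], so the slope [r'] costs at most [r]. *)
  pose r' := r / (sigma T t - a).
  have sa : 0 < sigma T t - a by have := le_sigma Tt; lra.
  have [|dl dl0 H] := small _ r' kt; first by rewrite divr_gt0.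
  have [|s Ts /andP[sd st]] := ld (Num.min dl (t - a)).
    by rewrite lt_min dl0 subr_gt0.
  have m1 : Num.min dl (t - a) <= dl by rewrite ge_min lexx.
  have m2 : Num.min dl (t - a) <= t - a by rewrite ge_min lexx orbT.
  have {}H : `|D t - D s| <= r.
    have : `|D t - D s| <= r' * `|sigma T t - s| by apply: H => //; lra.
    move=> /le_trans; apply; have ts := le_sigma Tt.
    rewrite ger0_norm; last by lra.
    rewrite /r' mulrAC -mulrA ler_piMr ?(ltW r0) // ler_pdivrMr // mul1r; lra.
  have {}Pt : `|D s - D a| <= e' * (s - a) by apply: Pt => //; lra.
  rewrite (_ : D t - D a = (D t - D s) + (D s - D a)); last by rewrite addrA subrK.
  apply: le_trans (ler_normD _ _) _; apply: lerD => //.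
  by apply: le_trans Pt _; rewrite ler_pM2l // lerD2r ltW.
Qed.

(** [xget] returns the increment of some antiderivative [G]; it equals that of [F] because [G - F]
    has zero derivative and is therefore constant on [T]. *)
Lemma delta_integralE (F f : R -> quat R) r s : T r -> T s ->
  is_delta_antiderivative T F f -> delta_integral T f r s = F s - F r.
Proof.
move=> Tr Ts Ff; rewrite /delta_integral; case: xgetP => [v -> [G [Gf ->]]|]; last first.
  by move=> /(_ (F s - F r)) []; exists F.
have D0 t : kappa T t -> is_delta_derivative T (G \- F) t 0.
  by move=> kt; rewrite -[0](subrr (f t)); apply: is_delta_derivativeB; [exact: Gf|exact: Ff].
have : (G \- F) s = (G \- F) r.
  case/orP: (le_total r s) => [rs|sr]; first exact: delta_derivative0_const.
  by apply/esym/delta_derivative0_const.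
move=> /= E; rewrite -[G s](subrK (F s)) E.
by apply: quatP => /=; ring.
Qed.

End TimeScaleFacts.

(** * Lebesgue primitives of real functions [C] of the graininess *)

Section GapIntegral.
Variables (R : realType) (T : set R).
Hypothesis hT : time_scale T.
Implicit Types (r s t x e : R).

(** For [x] outside [T] with points of [T] below it, this is the left endpoint of the gap around
    [x]. *)
Definition ts_floor x : R := sup [set s | T s /\ s <= x].

Lemma ts_floorP s x : T s -> s <= x ->
  [/\ T (ts_floor x), s <= ts_floor x <= x
    & forall r, T r -> r <= x -> r <= ts_floor x].
Proof.
move=> Ts sx; have n0 : [set s | T s /\ s <= x] !=set0 by exists s.
have ub : has_ubound [set s | T s /\ s <= x] by exists x => r [].
split.
- by apply: (closed_set_sup hT) => // r [].
- by rewrite ub_le_sup //= ge_sup // => r [].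
- by move=> r Tr rx; apply: ub_le_sup.
Qed.

Lemma ts_floor_eq t x : T t -> t <= x -> (forall r, T r -> r <= x -> r <= t) ->
  ts_floor x = t.
Proof.
move=> Tt tx H; have [Tf /andP[tf fx] _] := ts_floorP Tt tx.
by apply/eqP; rewrite eq_le tf H.
Qed.

Variable C : R -> R.
Hypothesis C_cvg0 : forall e, 0 < e -> exists2 dl, 0 < dl &
  forall h, 0 <= h < dl -> `|C h - C 0| <= e.

Definition gap_step x : R :=
  if `[< T x >] then C 0 else C (mu T (ts_floor x)).

(* Off [T], [gap_step] is locally constant, since [ts_floor] is; so no
   measurability of [C] is needed. *)
Lemma measurable_gap_step : measurable_fun setT gap_step.
Proof.
move=> _ Y mY; rewrite setTI.
have -> : gap_step @^-1` Y = (~` T `&` gap_step @^-1` Y) `|` (T `&` gap_step @^-1` Y).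
  by rewrite -setIUl setUC setUv setTI.
have [_ cT] := hT; apply: measurableU.
  apply: open_measurable; rewrite openE => x [nTx Yx].
  have oT : open (~` T) by exact: closed_openC.
  have /nbhs_ballP[d /= d0 H] := open_nbhs_nbhs (conj oT nTx).
  apply/nbhs_ballP; exists d => // y xy; have nTy := H _ xy; split=> //=.
  suff E : ts_floor y = ts_floor x.
    move: Yx; rewrite /= /gap_step.
    by case: asboolP => // _; case: asboolP => // _; rewrite E.
  congr sup; apply/seteqP; split=> r /= [Tr ry]; split=> //; rewrite leNgt;
    apply/negP => xr; apply: (H r) => //; move: xy; rewrite /ball /= => xy.
    by rewrite ltr_norml; move: xy; rewrite ltr_norml; lra.
  by rewrite ltr_norml; move: xy; rewrite ltr_norml; lra.
have mT : measurable T by exact: closed_measurable.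
case: (pselect (Y (C 0))) => YC.
  rewrite (_ : T `&` _ = T) //; apply/seteqP; split=> [x [] //|x Tx]; split=> //=.
  by rewrite /gap_step asboolT.
rewrite (_ : T `&` _ = set0) //; apply/seteqP; split=> x [] //= Tx.
by rewrite /gap_step asboolT.
Qed.

(** Since [s] and [t] belong to [T], the gap around [x] cannot extend beyond them. On short
    intervals [gap_step] thus evaluates [C] only near 0. *)
Lemma mu_floor_le s t x : T s -> T t -> s <= x <= t -> ~ T x ->
  0 <= mu T (ts_floor x) <= t - s.
Proof.
move=> Ts Tt /andP[sx xt] nTx; have [Tf /andP[sf fx] _] := ts_floorP Ts sx.
rewrite mu_ge0 //= /mu lerB // sigma_le //.
rewrite lt_neqAle (le_trans fx xt) andbT; apply/eqP => E; apply: nTx.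
by rewrite (_ : x = ts_floor x) //; apply/eqP; rewrite eq_le fx E xt.
Qed.

(** Nothing is known about [C] away from 0, so long gaps need counting. On gaps shorter than [d] the
    values stay within 1 of [C 0]; the rest is an induction along pieces of length [d / 2]. *)
Lemma gap_step_bounded s t : T s -> exists M, forall x, s <= x <= t -> `|gap_step x| <= M.
Proof.
move=> Ts; have [d d0 Cd] := C_cvg0 ltr01.
have C1 h : 0 <= h < d -> `|C h| <= `|C 0| + 1.
  move=> /Cd Ch; rewrite -[C h](subrK (C 0)).
  by apply: le_trans (ler_normD _ _) _; rewrite addrC lerD2l.
suff [N HN] : exists N : nat, t <= s + N%:R * (d / 2).
  suff [M HM] : exists M, forall x, s <= x <= s + N%:R * (d / 2) -> `|gap_step x| <= M.
    by exists M => x /andP[sx xt]; apply: HM; rewrite sx (le_trans xt).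
  elim: N {HN} => [|N [M HM]].
    exists `|gap_step s| => x; rewrite mul0r addr0 => /andP[sx xs].
    by rewrite (_ : x = s) //; apply/eqP; rewrite eq_le xs sx.
  pose x0 := s + N%:R * (d / 2); pose y := x0 + d / 2.
  pose B r := `|C (mu T (ts_floor r))|.
  (* A gap of length at least [d] that meets the new piece either starts at or before [x0] or
     extends past [y]. Its value is therefore the one read off at [x0] or at [y]. *)
  exists (`|M| + `|C 0| + 1 + B x0 + B y) => x.
  rewrite -natr1 mulrDl mul1r addrA -/x0 -/y => /andP[sx xy].
  have B0 r : 0 <= B r by exact: normr_ge0.
  have := B0 x0; have := B0 y; have := normr_ge0 (C 0); have := normr_ge0 M => ? ? ? ?.
  case: (leP x x0) => [xx0|x0x].
    have : `|gap_step x| <= M by apply: HM; rewrite sx.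
    have := ler_norm M; lra.
  rewrite /gap_step; case: asboolP => [_|nTx]; first by lra.
  have [Tf /andP[sf fx] fmax] := ts_floorP Ts sx.
  case: (ltP (mu T (ts_floor x)) d) => [mud|dmu].
    have : `|C (mu T (ts_floor x))| <= `|C 0| + 1 by apply: C1; rewrite mu_ge0.
    lra.
  case: (leP (ts_floor x) x0) => [fx0|x0f].
    have E : ts_floor x0 = ts_floor x.
      by apply: ts_floor_eq => // r Tr rx0; apply: fmax => //; apply: le_trans rx0 (ltW x0x).
    by rewrite -E -/(B x0); lra.
  have E : ts_floor y = ts_floor x.
    apply: ts_floor_eq => //; first exact: le_trans fx xy.
    move=> r Tr ry; rewrite leNgt; apply/negP => fr.
    have := sigma_le Tr fr; move: dmu ry x0f; rewrite /mu /y; lra.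
  by rewrite -E -/(B y); lra.
exists (Num.bound (`|t - s| / (d / 2))).
have d20 : 0 < d / 2 by rewrite divr_gt0.
have := archi_boundP (divr_ge0 (normr_ge0 (t - s)) (ltW d20)).
rewrite ltr_pdivrMr // => /ltW H; rewrite -lerBlDl.
exact: le_trans (ler_norm _) H.
Qed.

Local Notation leb := (@lebesgue_measure R).

Lemma integrable_cst_itv (k : R) s t : leb.-integrable `[s, t] (EFin \o cst k).
Proof.
apply: measurable_bounded_integrable => //=; last exact: bounded_cst.
by rewrite lebesgue_measure_itv /=; case: ifP => // _; rewrite -EFinB ltry.
Qed.

Lemma integrable_gap_step s t : T s -> leb.-integrable `[s, t] (EFin \o gap_step).
Proof.
move=> Ts; apply: measurable_bounded_integrable => //=.
- by rewrite lebesgue_measure_itv /=; case: ifP => // _; rewrite -EFinB ltry.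
- by apply: measurable_funS measurable_gap_step.
have [M HM] := gap_step_bounded t Ts.
exists M; split; rewrite ?num_real // => y My x /=; rewrite in_itv /= => xst.
exact: le_trans (HM _ xst) (ltW My).
Qed.

Let I s t : R := \int[leb]_(x in `[s, t]) gap_step x.

Lemma gap_integralD r s t : T r -> T s -> r <= s <= t -> I r t = I r s + I s t.
Proof.
move=> Tr Ts /andP[rs st]; apply/eqP; rewrite addrC -subr_eq; apply/eqP.
rewrite /I Rintegral_itvB; last 3 first.
- exact: integrable_gap_step.
- by rewrite bnd_simp.
- by rewrite bnd_simp.
rewrite Rintegral_itv_obnd_cbnd //.
apply: integrableS (integrable_gap_step t Ts) => //.
by move=> x /=; rewrite !in_itv /= => /andP[/ltW -> ->].
Qed.

Lemma gap_integral_xx t : I t t = 0.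
Proof. by rewrite /I set_itv1 Rintegral_set1. Qed.

Lemma Rintegral_cst_itv (k : R) s t : s <= t -> \int[leb]_(x in `[s, t]) k = k * (t - s).
Proof.
move=> st; rewrite Rintegral_cst //= lebesgue_measure_itv /= lte_fin.
case: ltP => [_|ts] //=; rewrite (_ : t = s) ?subrr //.
by apply/eqP; rewrite eq_le ts st.
Qed.

Lemma gap_integral_sigma t : T t -> I t (sigma T t) = mu T t * C (mu T t).
Proof.
move=> Tt; have := le_sigma Tt; rewrite le_eqVlt => /orP[/eqP E|tst].
  by rewrite -E gap_integral_xx /mu -E subrr mul0r.
rewrite mulrC -(Rintegral_cst_itv _ (ltW tst)) /I /Rintegral.
(* The endpoints, where [gap_step] equals [C 0], are discarded as a null set; on the open gap it is
   the constant [C (mu T t)]. *)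
rewrite (@integral_itv_bndoo _ t (sigma T t) (EFin \o gap_step)); last first.
  by apply/measurable_EFinP; apply: measurable_funS measurable_gap_step.
rewrite (@integral_itv_bndoo _ t (sigma T t) (fun=> (C (mu T t))%:E)) //.
congr fine; apply: eq_integral => x; rewrite inE /= in_itv /= => /andP[tx xs].
have gap r : T r -> r <= x -> r <= t.
  move=> Tr rx; rewrite leNgt; apply/negP => tr.
  by have := sigma_le Tr tr; lra.
rewrite /gap_step asboolF => [|Tx]; first by rewrite (ts_floor_eq Tt (ltW tx) gap).
by have := gap _ Tx (lexx x); lra.
Qed.

(** All gaps between [s] and [t] are shorter than [dl], so the integrand stays within [e] of [C 0].
    The choice of [dl] is uniform in [s] and [t]. *)
Lemma gap_integral_approx e : 0 < e -> exists2 dl, 0 < dl &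
  forall s t, T s -> T t -> s <= t < s + dl -> `|I s t - C 0 * (t - s)| <= e * (t - s).
Proof.
move=> e0; have [dl dl0 H] := C_cvg0 e0; exists dl => // s t Ts Tt /andP[st ts].
rewrite -!Rintegral_cst_itv // /I.
have ig := integrable_gap_step t Ts; have ic := integrable_cst_itv (C 0) s t.
have iB : leb.-integrable `[s, t] (EFin \o (fun x => gap_step x - C 0)).
  exact: (integrableB _ ig ic).
rewrite -RintegralB //; apply: le_trans (le_normr_Rintegral _ iB) _ => //.
apply: le_Rintegral => //.
- exact: (integrable_norm iB).
- exact: integrable_cst_itv.
move=> x /=; rewrite in_itv /= => xst; rewrite /gap_step.
case: asboolP => [_|nTx]; first by rewrite subrr normr0 ltW.
by apply: H; have := mu_floor_le Ts Tt xst nTx; lra.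
Qed.

Lemma exists_gap_primitive : T 0 -> exists F : R -> R,
  (forall t, T t -> F (sigma T t) = F t + mu T t * C (mu T t)) /\
  (forall e, 0 < e -> exists2 dl, 0 < dl & forall s t, T s -> T t ->
     s <= t < s + dl -> `|F t - F s - C 0 * (t - s)| <= e * (t - s)).
Proof.
move=> T0; pose F t := if 0 <= t then I 0 t else - I t 0.
have FB s t : T s -> T t -> s <= t -> F t - F s = I s t.
  move=> Ts Tt st; rewrite /F; case: leP => [t0|t0]; case: leP => [s0|s0]; last 2 first.
  - lra.
  - by rewrite (@gap_integralD s t 0) ?st 1?ltW //; ring.
  - by rewrite (@gap_integralD 0 s t) ?s0 ?st //; ring.
  - by rewrite opprK (@gap_integralD s 0 t) ?(ltW s0) ?t0 //; ring.
exists F; split.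
  move=> t Tt; rewrite -gap_integral_sigma // -FB ?le_sigma //; last exact: sigma_in.
  by ring.
move=> e e0; have [dl dl0 H] := gap_integral_approx e0; exists dl => // s t Ts Tt std.
by rewrite FB //; [exact: H | case/andP: std].
Qed.

End GapIntegral.

(** * The quaternion exponential on the planes R + R u *)

Section QuaternionExponential.
Variable R : realType.
Implicit Types (a b e h x : R) (l u p q z : quat R).

Definition imaginary_unit u := qre u = 0 /\ sqnormq u = 1.

Definition qplane u a b : quat R := qreal a + b *: u.

Lemma qplaneM u a b c d : imaginary_unit u ->
  qplane u a b * qplane u c d = qplane u (a * c - b * d) (a * d + b * c).
Proof.
case=> u0; rewrite /sqnormq u0 => E; apply: quatP => /=; rewrite u0; last 3 first.
1-3: by ring.
transitivity (a * c - b * d * (0 ^+ 2 + qi u ^+ 2 + qj u ^+ 2 + qk u ^+ 2)).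
  by ring.
by rewrite E; ring.
Qed.

Lemma qplaneD u a b c d : qplane u a b + qplane u c d = qplane u (a + c) (b + d).
Proof. by apply: quatP => /=; ring. Qed.

Lemma qplaneN u a b : - qplane u a b = qplane u (- a) (- b).
Proof. by apply: quatP => /=; ring. Qed.

Lemma qplaneZ u c a b : c *: qplane u a b = qplane u (c * a) (c * b).
Proof. by apply: quatP => /=; ring. Qed.

Lemma qplane1 u : 1 = qplane u 1 0.
Proof. by apply: quatP => /=; ring. Qed.

Lemma normqE q : `|q| = Num.sqrt (sqnormq q). Proof. by []. Qed.

Lemma normqM p q : `|p * q| = `|p| * `|q|.
Proof.
rewrite !normqE -sqrtrM ?sqnormq_ge0 //; congr Num.sqrt.
by rewrite /sqnormq /=; ring.
Qed.

Lemma norm_qplane u a b : imaginary_unit u -> `|qplane u a b| = Num.sqrt (a ^+ 2 + b ^+ 2).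
Proof.
case=> u0; rewrite normqE /sqnormq u0 /= => E; congr Num.sqrt; rewrite u0.
transitivity (a ^+ 2 + b ^+ 2 * (0 ^+ 2 + qi u ^+ 2 + qj u ^+ 2 + qk u ^+ 2)).
  by ring.
by rewrite E mulr1.
Qed.

Lemma norm_qplane_le u a b : imaginary_unit u -> `|qplane u a b| <= `|a| + `|b|.
Proof.
move=> hu; rewrite norm_qplane // -(ger0_norm (addr_ge0 (normr_ge0 a) (normr_ge0 b))).
rewrite -sqrtr_sqr ler_wsqrtr // sqrrD !real_normK ?num_real //.
by rewrite lerD2r lerDl mulrn_wge0 // mulr_ge0.
Qed.

Lemma norm_qplane_ge u a b : imaginary_unit u ->
  `|a| <= `|qplane u a b| /\ `|b| <= `|qplane u a b|.
Proof.
move=> hu; rewrite norm_qplane // -!sqrtr_sqr.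
by split; apply: ler_wsqrtr; rewrite ?lerDl ?lerDr sqr_ge0.
Qed.

(* For real [q] we take u = i, the unit chosen by [qLn] on negative reals. *)
Definition qunit q : quat R := if qvec q == 0 then qI R else `|qvec q|^-1 *: qvec q.

Lemma qunitP q : imaginary_unit (qunit q).
Proof.
rewrite /imaginary_unit /qunit; case: eqVneq => [_|q0].
  by split=> //; rewrite /sqnormq /=; ring.
split; first by rewrite /= mulr0.
have n0 : `|qvec q| ^+ 2 != 0 by rewrite expf_neq0 // normr_eq0.
rewrite -[RHS](mulfV n0) -exprVn {2}normqE sqr_sqrtr ?sqnormq_ge0 //.
by rewrite /sqnormq /=; ring.
Qed.

Lemma qplane_qunit q : q = qplane (qunit q) (qre q) `|qvec q|.
Proof.
rewrite /qplane /qunit; case: eqVneq => [q0|q0].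
  rewrite q0 normr0 scale0r addr0.
  by case: q0 => *; apply: quatP.
rewrite scalerA mulfV ?normr_eq0 // scale1r.
by apply: quatP; rewrite /= ?addr0 ?add0r.
Qed.

(** Real and imaginary parts of the complex power (a + b i)^k. *)
Fixpoint plane_pow a b k : R * R :=
  if k is k'.+1 then
    let: (r, s) := plane_pow a b k' in (a * r - b * s, a * s + b * r)
  else (1, 0).

Lemma qplaneX u a b k : imaginary_unit u ->
  qplane u a b ^+ k = qplane u (plane_pow a b k).1 (plane_pow a b k).2.
Proof.
move=> hu; elim: k => [|k IH]; first by rewrite expr0 /= -qplane1.
by rewrite exprS IH qplaneM //=; case: (plane_pow a b k) => r s.
Qed.

Lemma plane_pow_le a b k :
  `|(plane_pow a b k).1| <= (`|a| + `|b|) ^+ k /\ `|(plane_pow a b k).2| <= (`|a| + `|b|) ^+ k.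
Proof.
elim: k => [|k] /=; first by rewrite expr0 normr1 normr0.
case: (plane_pow a b k) => r s /= [hr hs]; rewrite exprS mulrDl; split.
  apply: le_trans (ler_normB _ _) _; rewrite !normrM; apply: lerD; exact: ler_wpM2l.
apply: le_trans (ler_normD _ _) _; rewrite !normrM; apply: lerD; exact: ler_wpM2l.
Qed.

Lemma cvg_pseries_fact (c : R^nat) K M x : 0 <= M -> (forall k, `|c k| <= K * M ^+ k) ->
  cvgn (pseries (fun k => c k / k`!%:R) x).
Proof.
move=> M0 cK; apply: normed_cvg.
have vE k : `|c k / k`!%:R * x ^+ k| <= K * exp_coeff (M * `|x|) k.
  rewrite /exp_coeff /= exprMn !normrM normrX normfV normr_nat.
  by rewrite mulrAC !mulrA ler_wpM2r ?invr_ge0 // ler_wpM2r // exprn_ge0.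
apply: (@series_le_cvg _ _ (fun k => K * exp_coeff (M * `|x|) k)) => [k|k|k|]//=.
- exact: le_trans (vE k).
- exact/is_cvg_seriesZ/is_cvg_series_exp_coeff.
Qed.

(** Formal differentiation of an exponential generating series shifts its coefficients by one. *)
Lemma pseries_diffs_fact (c : R^nat) :
  pseries_diffs (fun k => c k / k`!%:R) = (fun k => c k.+1 / k`!%:R).
Proof.
apply/funext => k; rewrite /pseries_diffs factS natrM invfM.
by rewrite mulrCA mulrA mulrA mulfK // mulrC.
Qed.

Lemma lim_pseries0 (c : R^nat) : limn (pseries c 0) = c 0%N.
Proof.
apply: lim_near_cst => //; near=> m.
rewrite -[m]prednK; last by near: m.
rewrite /pseries /series /= big_nat_recl //= expr0 mulr1 big1 ?addr0 // => i _.
by rewrite exprS mul0r mulr0.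
Unshelve. all: by end_near. Qed.

Lemma is_derive_pseries_fact (c : R^nat) M x : 0 <= M -> (forall k, `|c k| <= M ^+ k) ->
  is_derive x 1 (fun y => limn (pseries (fun k => c k / k`!%:R) y))
    (limn (pseries (fun k => c k.+1 / k`!%:R) x)).
Proof.
move=> M0 cM; have E := pseries_diffs_fact.
rewrite -E; apply: (@pseries_snd_diffs _ _ (`|x| + 1)).
- by apply: (@cvg_pseries_fact _ 1 M) => // k; rewrite mul1r.
- by rewrite E; apply: (@cvg_pseries_fact _ M M) => // k; rewrite -exprS.
- by rewrite !E; apply: (@cvg_pseries_fact _ (M ^+ 2) M) => // k; rewrite -exprD.
- by rewrite [ltRHS]ger0_norm ?addr_ge0 // ltrDl.
Qed.

(** With a variable [x] in place of 1, the sums [f] and [g] are the coordinates of exp(x(a + b i)).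
    They solve f' = a f - b g, g' = a g + b f with the initial values 1 and 0, as do e^(ax) cos(bx)
    and e^(ax) sin(bx); the two solutions agree at [x = 1]. *)
Lemma lim_plane_pow a b :
  limn (pseries (fun k => (plane_pow a b k).1 / k`!%:R) 1) = expR a * cos b /\
  limn (pseries (fun k => (plane_pow a b k).2 / k`!%:R) 1) = expR a * sin b.
Proof.
pose M := `|a| + `|b|; have M0 : 0 <= M by rewrite addr_ge0.
pose r k := (plane_pow a b k).1; pose s k := (plane_pow a b k).2.
have rS k : r k.+1 = a * r k - b * s k by rewrite /r /s /=; case: (plane_pow a b k).
have sS k : s k.+1 = a * s k + b * r k by rewrite /r /s /=; case: (plane_pow a b k).
have rM k : `|r k| <= M ^+ k by have [] := plane_pow_le a b k.
have sM k : `|s k| <= M ^+ k by have [] := plane_pow_le a b k.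
pose f x := limn (pseries (fun k => r k / k`!%:R) x).
pose g x := limn (pseries (fun k => s k / k`!%:R) x).
have cr x : cvgn (pseries (fun k => r k / k`!%:R) x).
  by apply: (@cvg_pseries_fact _ 1 M) => // k; rewrite mul1r.
have cs x : cvgn (pseries (fun k => s k / k`!%:R) x).
  by apply: (@cvg_pseries_fact _ 1 M) => // k; rewrite mul1r.
have df x : is_derive x 1 f (a * f x - b * g x).
  have := @is_derive_pseries_fact r M x M0 rM.
  rewrite (_ : limn (pseries (fun k => r k.+1 / k`!%:R) x) = a * f x - b * g x) //.
  apply: cvg_lim => //.
  rewrite (_ : pseries _ _ = (fun n => a * pseries (fun k => r k / k`!%:R) x n
                               - b * pseries (fun k => s k / k`!%:R) x n)).
    by apply: cvgB; apply: cvgM => //; apply: cvg_cst.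
  apply/funext => n; rewrite /pseries /series /= !mulr_sumr -sumrB.
  by apply: eq_bigr => k _; rewrite rS; ring.
have dg x : is_derive x 1 g (a * g x + b * f x).
  have := @is_derive_pseries_fact s M x M0 sM.
  rewrite (_ : limn (pseries (fun k => s k.+1 / k`!%:R) x) = a * g x + b * f x) //.
  apply: cvg_lim => //.
  rewrite (_ : pseries _ _ = (fun n => a * pseries (fun k => s k / k`!%:R) x n
                               + b * pseries (fun k => r k / k`!%:R) x n)).
    by apply: cvgD; apply: cvgM => //; apply: cvg_cst.
  apply/funext => n; rewrite /pseries /series /= !mulr_sumr -big_split /=.
  by apply: eq_bigr => k _; rewrite sS; ring.
have f0 : f 0 = 1.
  by rewrite /f lim_pseries0 /= invr1 mulr1.
have g0 : g 0 = 0.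
  by rewrite /g lim_pseries0 /= mul0r.
(* The squared distance of the two solutions grows with rate [2 * a]; the exponential factor cancels
   this growth and makes [D] constant. *)
pose D x := ((f x - expR (a * x) * cos (b * x)) ^+ 2 +
             (g x - expR (a * x) * sin (b * x)) ^+ 2) * expR (- (2 * a) * x).
have D10 : D 1 = D 0.
  apply: is_derive_0_is_cst => x; rewrite /D.
  apply: trigger_derive; rewrite /GRing.scale /=.
  by ring.
have : D 1 = 0 by rewrite D10 /D f0 g0 !mulr0 expR0 cos0 sin0; ring.
rewrite /D !mulr1 => /eqP; rewrite mulf_eq0 (gt_eqF (expR_gt0 _)) orbF.
rewrite paddr_eq0 ?sqr_ge0 // !sqrf_eq0 !subr_eq0.
by case/andP => /eqP + /eqP.
Qed.
Lemma qexp_qplane u a b : imaginary_unit u ->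
  qexp (qplane u a b) = qplane u (expR a * cos b) (expR a * sin b).
Proof.
move=> hu; rewrite /qexp; apply: cvg_lim => //.
have M0 : 0 <= `|a| + `|b| by rewrite addr_ge0.
have [Lr Ls] := lim_plane_pow a b.
pose r k := (plane_pow a b k).1; pose s k := (plane_pow a b k).2.
have cr : pseries (fun k => r k / k`!%:R) 1 @ \oo --> expR a * cos b.
  rewrite -Lr; apply: (@cvg_pseries_fact _ 1) M0 _ => k.
  by rewrite mul1r; have [] := plane_pow_le a b k.
have cs : pseries (fun k => s k / k`!%:R) 1 @ \oo --> expR a * sin b.
  rewrite -Ls; apply: (@cvg_pseries_fact _ 1) M0 _ => k.
  by rewrite mul1r; have [] := plane_pow_le a b k.
have E n : series (fun k => (k`!%:R : R)^-1 *: qplane u a b ^+ k) n =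
    qplane u (pseries (fun k => r k / k`!%:R) 1 n) (pseries (fun k => s k / k`!%:R) 1 n).
  rewrite /pseries /series /=; elim: n => [|n IH].
    by rewrite !big_geq //; apply: quatP => /=; ring.
  rewrite !big_nat_recr //= IH qplaneX // qplaneZ qplaneD !expr1n !mulr1.
  by rewrite ![_^-1 * _]mulrC.
apply/cvgrPdist_le => e e0; have e20 : 0 < e / 2 by rewrite divr_gt0.
near=> n; rewrite E qplaneN qplaneD; apply: le_trans (norm_qplane_le _ _ hu) _.
rewrite [e]splitr; apply: lerD.
  by near: n; move/cvgrPdist_le : cr; apply.
by near: n; move/cvgrPdist_le : cs; apply.
Unshelve. all: by end_near. Qed.

Lemma qexp0 : qexp 0 = 1 :> quat R.
Proof.
have hu := qunitP 0; rewrite (_ : 0 = qplane (qunit 0) 0 0); last first.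
  by apply: quatP => /=; ring.
by rewrite qexp_qplane // expR0 cos0 sin0 mulr1 mulr0 -qplane1.
Qed.

Lemma qexpD_qplane u a b c d : imaginary_unit u ->
  qexp (qplane u a b + qplane u c d) = qexp (qplane u a b) * qexp (qplane u c d).
Proof.
move=> hu; rewrite qplaneD !qexp_qplane // qplaneM // expRD cosD sinD.
by congr qplane; ring.
Qed.

Lemma is_derive_approx (f : R -> R) (x c : R) : is_derive x 1 f c ->
  forall e, 0 < e -> exists2 dl, 0 < dl & forall h, `|h| < dl ->
    `|f (h + x) - f x - c * h| <= e * `|h|.
Proof.
move=> [df dE] e e0.
have : h^-1 *: (f (h + x) - f x) @[h --> 0^'] --> c.
  rewrite -dE; move: df; rewrite /derivable /derive.
  rewrite (_ : (fun h : R => _) = (fun h : R => h^-1 *: (f (h + x) - f x))) //.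
  by apply/funext => h /=; rewrite [h *: _]mulr1.
move/cvgrPdist_le => /(_ _ e0); rewrite near_withinE => /nbhs_ballP[dl /= dl0 H].
exists dl => // h hdl; case: (eqVneq h 0) => [->|h0].
  by rewrite add0r subrr mulr0 subr0 !normr0 mulr0.
have {}H : `|c - h^-1 *: (f (h + x) - f x)| <= e.
  by apply: H => //; rewrite /ball /= sub0r normrN.
rewrite -(@ler_pM2r _ `|h|) ?normr_gt0 // -normrM in H.
rewrite distrC; apply: le_trans H; rewrite le_eqVlt; apply/orP; left; apply/eqP.
by congr `|_|; rewrite /GRing.scale /= mulrBl mulrAC mulVf // mul1r.
Qed.

(** In the plane of [z] this reduces to the first-order expansions of the real functions exp, cos
    and sin at 0. *)
Lemma qexp_approx e : 0 < e -> exists2 dl, 0 < dl & forall z, `|z| < dl ->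
  `|qexp z - 1 - z| <= e * `|z|.
Proof.
(* Each coordinate costs at most three times [r * |z|], and the product [a * b] in the second one
   costs one more: seven in all. The bound [r <= 1] gives [|1 + a| <= 2]. *)
move=> e0; have [r r0 [re r1]] : exists2 r, 0 < r & r <= e / 7 /\ r <= 1.
  exists (Num.min (e / 7) 1); first by rewrite lt_min ltr01 divr_gt0.
  by split; rewrite ge_min lexx ?orbT.
have [d1 d10 H1] := is_derive_approx (is_derive_expR 0) r0.
have [d2 d20 H2] := is_derive_approx (is_derive_cos 0) r0.
have [d3 d30 H3] := is_derive_approx (is_derive_sin 0) r0.
exists (Num.min (Num.min d1 d2) (Num.min d3 r)); first by rewrite !lt_min d10 d20 d30.
move=> z; rewrite !lt_min => /andP[/andP[z1 z2] /andP[z3 z4]].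
have hu := qunitP z; rewrite {1 2}[z]qplane_qunit qexp_qplane //.
move: (qunit z) hu (qplane_qunit z) => u hu.
set a := qre z; set b := `|qvec z| => Ez.
have [az bz] := norm_qplane_ge a b hu; rewrite -Ez in az bz.
rewrite (qplane1 u) !qplaneN !qplaneD; apply: le_trans (norm_qplane_le _ _ hu) _.
have {}H1 : `|expR a - 1 - a| <= r * `|a|.
  by have := H1 a (le_lt_trans az z1); rewrite addr0 expR0 mul1r.
have {}H2 : `|cos b - 1| <= r * `|b|.
  by have := H2 b (le_lt_trans bz z2); rewrite addr0 cos0 sin0 oppr0 mul0r subr0.
have {}H3 : `|sin b - b| <= r * `|b|.
  by have := H3 b (le_lt_trans bz z3); rewrite addr0 sin0 cos0 mul1r subr0.
have a1 : `|1 + a| <= 2.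
  apply: le_trans (ler_normD _ _) _; rewrite normr1; move: z4 az r1; lra.
have bound c d k : `|c| <= 1 -> `|d - k| <= r * `|b| ->
    `|(expR a - 1 - a) * c + (1 + a) * (d - k)| <= r * `|a| + 2 * (r * `|b|).
  move=> c1 dk; apply: le_trans (ler_normD _ _) _; rewrite !normrM; apply: lerD.
    by apply: le_trans H1; rewrite ler_piMr.
  by apply: ler_pM.
rewrite (_ : expR a * cos b + - 1 + - a =
  (expR a - 1 - a) * cos b + (1 + a) * (cos b - 1)); last by ring.
rewrite (_ : expR a * sin b + - 0 + - b =
  ((expR a - 1 - a) * sin b + (1 + a) * (sin b - b)) + a * b); last by ring.
have B1 := bound _ _ _ (cos_max b) H2; have B2 := bound _ _ _ (sin_max b) H3.
apply: le_trans (lerD B1 (ler_normD _ _)) _.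
apply: le_trans (lerD (lexx _) (lerD B2 (lexx _))) _; rewrite normrM.
have ab : `|a| * `|b| <= r * `|b|.
  by rewrite ler_wpM2r //; apply: le_trans az (ltW z4).
have ra : r * `|a| <= r * `|z| by rewrite ler_pM2l.
have rb : r * `|b| <= r * `|z| by rewrite ler_pM2l.
have rz : r * `|z| <= e / 7 * `|z| by rewrite ler_wpM2r.
lra.
Qed.

(** * The principal logarithm and the maps xi_h near [h = 0] *)

Definition qarg q : R := if qvec q == 0 then pi * ((1 - Num.sg (qre q)) / 2)
  else acos (qre q / `|q|).

Lemma qLnE q : qLn q = qplane (qunit q) (ln `|q|) (qarg q).
Proof.
rewrite /qLn /qarg /qunit; case: eqP => // _.
by rewrite /qplane scalerA.
Qed.

Lemma normq_sqr q : `|q| ^+ 2 = qre q ^+ 2 + `|qvec q| ^+ 2.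
Proof. by rewrite !normqE !sqr_sqrtr ?sqnormq_ge0 // /sqnormq /=; ring. Qed.

Lemma qre_norm q : `|qre q| <= `|q|.
Proof.
by rewrite -ler_sqr ?nnegrE // normq_sqr real_normK ?num_real // lerDl sqr_ge0.
Qed.

Lemma qre_div_norm q : q != 0 -> -1 <= qre q / `|q| <= 1.
Proof.
move=> q0; rewrite -ler_norml normrM normfV normr_id ler_pdivrMr ?normr_gt0 //.
by rewrite mul1r qre_norm.
Qed.

(** In the plane of [qunit q] the claim is the polar form of [q]: norm times cosine is the scalar
    part, norm times sine the length of the vector part. For real [q] the angle is 0 or pi according
    to the sign. *)
Lemma qexp_qLn q : q != 0 -> qexp (qLn q) = q.
Proof.
move=> q0; have hu := qunitP q; rewrite qLnE qexp_qplane //.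
have n0 : 0 < `|q| by rewrite normr_gt0.
rewrite lnK ?posrE // [RHS]qplane_qunit; congr qplane; rewrite /qarg.
  case: eqVneq => [v0|v0]; last by rewrite acosK ?in_itv /= ?qre_div_norm // mulrC divfK ?gt_eqF.
  have := normq_sqr q; rewrite v0 normr0 expr0n addr0 => /eqP.
  have [E|r0|r0] := sgrP (qre q).
  - by rewrite E expr0n /= sqrf_eq0 normr_eq0 (negPf q0).
  - rewrite subrr mul0r mulr0 cos0 mulr1 eqrXn2 ?ltW // => /eqP //.
  - rewrite opprK -(@mulr2n _ 1) divff // mulr1 cospi -[qre q ^+ 2]sqrrN eqrXn2 ?oppr_ge0 ?ltW //.
    by move=> /eqP ->; rewrite mulrN1 opprK.
case: eqVneq => [v0|v0].
  rewrite v0 normr0; suff -> : sin (pi * ((1 - Num.sg (qre q)) / 2)) = 0 by rewrite mulr0.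
  have [E|r0|r0] := sgrP (qre q).
  - have := normq_sqr q; rewrite v0 E normr0 expr0n /= addr0 => /eqP.
    by rewrite sqrf_eq0 normr_eq0 (negPf q0).
  - by rewrite subrr mul0r mulr0 sin0.
  - by rewrite opprK -(@mulr2n _ 1) divff // mulr1 sinpi.
(* Norm times sine is the square root of [|q| ^+ 2 - qre q ^+ 2], which is the length of the vector
   part. *)
rewrite sin_acos ?qre_div_norm //.
rewrite -[X in X * _ = _](ger0_norm (ltW n0)) -sqrtr_sqr -sqrtrM ?sqr_ge0 //.
rewrite mulrBr mulr1 expr_div_n mulrCA mulfV ?mulr1 ?expf_neq0 ?normr_eq0 //.
by rewrite normq_sqr addrC addKr sqrtr_sqr normr_id.
Qed.

Lemma normq1 : `|1 : quat R| = 1.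
Proof. by rewrite normqE /sqnormq /= expr1n expr0n /= !addr0 sqrtr1. Qed.

Lemma qLn_small e : 0 < e -> exists2 dl : R, 0 < dl & forall w : quat R, `|w| < dl ->
  1 + w != 0 /\ `|qLn (1 + w)| <= e.
Proof.
move=> e0; have e20 : 0 < e / 2 by rewrite divr_gt0.
have /cvgrPdist_le/(_ _ e20)/nbhs_ballP[d1 /= d10 H1] := @continuous_ln R 1 ltr01.
have [t t0 [te t1]] : exists2 t, 0 < t & t <= e / 2 /\ t <= 1 / 2.
  exists (Num.min (e / 2) (1 / 2)); first by rewrite lt_min e20 divr_gt0.
  by split; rewrite ge_min lexx ?orbT.
(* The angle is at most [t] as soon as its cosine is at least [c], that is,
   [c * |1 + w| <= qre (1 + w)]. This follows from [c * (1 + |w|) <= 1 - |w|], which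
   [|w| < (1 - c) / 2] ensures because [c < 1]. *)
pose c := cos t.
have tpi : t \in `[0, pi]%R.
  by rewrite in_itv /= (ltW t0); have := @pi_ge2 R; lra.
have c1 : c < 1.
  by rewrite -cos0 ltr_cos // in_itv /= lexx pi_ge0.
have c0 : 0 < c by apply: cos_gt0_pihalf; have := @pi_ge2 R; lra.
pose d2 := (1 - c) / 2; have d20 : 0 < d2 by rewrite divr_gt0 // subr_gt0.
exists (Num.min d1 d2); first by rewrite lt_min d10.
move=> w; rewrite lt_min => /andP[w1 w2].
have rew : qre (1 + w) = 1 + qre w by [].
have hr : `|qre w| <= `|w| := qre_norm w.
have rpos : c * (1 + `|w|) <= qre (1 + w).
  have : c * (1 + `|w|) <= c * (1 + d2) by rewrite ler_pM2l // lerD2l ltW.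
  have : c * d2 <= d2 by rewrite ler_piMl // ltW.
  have /ler_normlP[] := hr; rewrite rew /d2 in w2 *; lra.
have rpos0 : 0 < qre (1 + w).
  by apply: lt_le_trans rpos; rewrite mulr_gt0 // ltr_wpDr.
have w0 : 1 + w != 0 by apply/eqP => E; move: rpos0; rewrite E ltxx.
split=> //; have n0 : 0 < `|1 + w| by rewrite normr_gt0.
have N1 : `| `|1 + w| - 1| <= `|w|.
  have E : 1 + w - 1 = w by rewrite addrC addKr.
  by have := ler_dist_dist (1 + w) 1; rewrite E normq1.
rewrite qLnE; apply: le_trans (norm_qplane_le _ _ (qunitP _)) _.
rewrite [e]splitr; apply: lerD.
  have := H1 `|1 + w|; rewrite ln1 sub0r normrN; apply.
  by rewrite /ball /= distrC; apply: le_lt_trans N1 w1.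
rewrite /qarg; case: eqP => [_|_].
  by rewrite gtr0_sg // subrr mul0r mulr0 normr0 ltW.
apply: le_trans te; rewrite ger0_norm; last by rewrite acos_ge0 // qre_div_norm.
rewrite leNgt; apply/negP => tlt.
have := qre_div_norm w0 => hq.
have : cos (acos (qre (1 + w) / `|1 + w|)) < c.
  by rewrite ltr_cos // in_itv /= acos_ge0 ?acos_lepi.
rewrite acosK ?in_itv // ltr_pdivrMr // ltNge => /negP; apply.
apply: le_trans rpos; rewrite ler_pM2l // -lerBlDl.
by apply: le_trans N1; exact: ler_norm.
Qed.

(** Put w = h l and z = Ln(1 + w), so that exp z - 1 = w. Then [qexp_approx] bounds |w - z| by r
    |z|, and [r <= 1 / 2] turns this into 2 r |w|; division by [h] leaves 2 r |l|, which is at most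
    [e]. *)
Lemma cylinder_cvg0 l e : 0 < e -> exists2 dl, 0 < dl & forall h, 0 <= h < dl ->
  `|cylinder h l - l| <= e.
Proof.
move=> e0; pose r := Num.min (1 / 2) (e / (2 * `|l| + 1)).
have l0 : 0 < 2 * `|l| + 1 by rewrite ltr_wpDl // mulr_ge0.
have r0 : 0 < r by rewrite lt_min !divr_gt0.
have r2 : r <= 1 / 2 by rewrite ge_min lexx.
have re : r <= e / (2 * `|l| + 1) by rewrite ge_min lexx orbT.
have [d1 d10 H1] := qexp_approx r0.
have [|d2 d20 H2] := @qLn_small (d1 / 2); first by rewrite divr_gt0.
have l1 : 0 < `|l| + 1 by rewrite ltr_wpDl.
exists (d2 / (`|l| + 1)); first by rewrite divr_gt0.
move=> h /andP[h0 hd]; rewrite /cylinder; case: eqVneq => [_|hn0].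
  by rewrite subrr normr0 ltW.
have {}h0 : 0 < h by rewrite lt_neqAle eq_sym hn0.
pose w := h *: l; have nw : `|w| = h * `|l| by rewrite normrZ gtr0_norm.
have [|w1 zs] := H2 w.
  rewrite nw; apply: (@le_lt_trans _ _ (h * (`|l| + 1))); last by rewrite -ltr_pdivlMr.
  by rewrite ler_pM2l // lerDl.
set z := qLn (1 + w) in zs *.
have {}H1 : `|w - z| <= r * `|z|.
  have := H1 z; rewrite qexp_qLn // [1 + w]addrC addrK; apply.
  by apply: le_lt_trans zs _; rewrite ltr_pdivrMr // ltr_pMr // ltr1n.
have zw : `|z| <= 2 * `|w|.
  have : `|z| <= `|w| + `|w - z|.
    by rewrite -{1}(subKr w z); apply: ler_normB.
  have : r * `|z| <= 1 / 2 * `|z| by rewrite ler_wpM2r.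
  move: H1; lra.
rewrite (_ : h^-1 *: z - l = h^-1 *: (z - w)); last first.
  by rewrite scalerBr /w scalerA mulVf // scale1r.
rewrite normrZ normfV gtr0_norm // distrC ler_pdivrMl //.
apply: le_trans H1 _; apply: (@le_trans _ _ (r * (2 * `|w|))).
  by rewrite ler_pM2l.
rewrite nw (_ : r * (2 * (h * `|l|)) = h * (r * (2 * `|l|))); last by ring.
rewrite ler_pM2l //; apply: (@le_trans _ _ (r * (2 * `|l| + 1))).
  by rewrite ler_pM2l // lerDl.
by rewrite -ler_pdivlMr.
Qed.

(** For [h > 0] the vector part of 1 + h l is a positive multiple of that of l, so both have the
    same unit; for real l both units are i. *)
Lemma cylinder_qplane h l : 0 <= h ->
  exists ab : R * R, cylinder h l = qplane (qunit l) ab.1 ab.2.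
Proof.
move=> h0; rewrite /cylinder; case: eqVneq => [_|hn0].
  by exists (qre l, `|qvec l|); rewrite -qplane_qunit.
rewrite qLnE (_ : qunit (1 + h *: l) = qunit l); last first.
  have E : qvec (1 + h *: l) = h *: qvec l.
    by apply: quatP => /=; ring.
  rewrite /qunit E scaler_eq0 (negPf hn0) /=; case: eqP => // v0.
  rewrite normrZ (ger0_norm h0) scalerA invfM mulrAC mulVf // mul1r //.
by rewrite qplaneZ; eexists (_, _).
Qed.

End QuaternionExponential.

(** * Delta derivative of the exponential, and the solutions built from eigenvectors *)

Section DeltaExponential.
Variables (R : realType) (T : set R).
Hypothesis hT : time_scale T.
Implicit Types (s t e : R) (l c d p q : quat R).

(* At a right-scattered [t], [d'] may differ from [d]: there the local estimate
   serves only as continuity of [f] at [t]. *)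
Lemma is_delta_derivative_intro (f : R -> quat R) t d d' : T t ->
  f (sigma T t) = f t + mu T t *: d -> (mu T t = 0 -> d' = d) ->
  (forall e, 0 < e -> exists2 dl, 0 < dl & forall s, T s -> `|s - t| < dl ->
     `|f t - f s - (t - s) *: d'| <= e * `|t - s|) ->
  is_delta_derivative T f t d.
Proof.
move=> Tt fs dd' H e e0; have := mu_ge0 Tt; rewrite le_eqVlt => /orP[/eqP/esym m0|m0].
  have [dl dl0 {}H] := H _ e0; exists dl => // s Ts sd.
  have st : sigma T t = t by apply/eqP; rewrite -subr_eq0 -/(mu T t) m0.
  by rewrite st -dd' //; apply: H => //; rewrite ltr_norml; lra.
have [d1 d10 {}H] := H _ ltr01.
(* The local estimate and the change of slope from [d'] to [d] cost at most [K * |t - s|]. Within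
   [mu T t / 2] of [t] the distance from [s] to [sigma T t] is at least [mu T t / 2], so [d2] is
   chosen with [K * d2 = e * (mu T t / 2)]. *)
pose K := 1 + `|d' - d|; have K0 : 0 < K by rewrite ltr_wpDr.
pose d2 := e * (mu T t / 2) / K.
have d20 : 0 < d2 by rewrite !(divr_gt0, mulr_gt0).
have mt20 : 0 < mu T t / 2 by rewrite divr_gt0.
exists (Num.min d1 (Num.min d2 (mu T t / 2))); first by rewrite !lt_min d10 d20.
move=> s Ts sd.
have : `|s - t| < Num.min d1 (Num.min d2 (mu T t / 2)) by rewrite ltr_norml; lra.
rewrite !lt_min => /and3P[s1 s2 s3].
have sE : sigma T t = t + mu T t by rewrite /mu addrC subrK.
have -> : f (sigma T t) - f s - (sigma T t - s) *: d =
    (f t - f s - (t - s) *: d') + (t - s) *: (d' - d).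
  by rewrite fs sE; apply: quatP => /=; ring.
apply: le_trans (ler_normD _ _) _; rewrite normrZ.
apply: (@le_trans _ _ (K * `|t - s|)).
  rewrite /K mulrDl [`|_ - _| * `|_|]mulrC lerD2r; exact: H.
apply: (@le_trans _ _ (K * d2)); first by rewrite ler_pM2l // distrC ltW.
rewrite /d2 mulrCA mulfV ?gt_eqF // mulr1 ler_pM2l // sE.
apply: le_trans (ler_norm _).
by move: s3; rewrite ltr_norml; lra.
Qed.

Lemma is_delta_derivativeMl c (f : R -> quat R) t d :
  is_delta_derivative T f t d -> is_delta_derivative T (fun s => c * f s) t (c * d).
Proof.
move=> H e e0; have c0 : 0 < `|c| + 1 by rewrite ltr_wpDl.
have [|dl dl0 {}H] := H (e / (`|c| + 1)); first by rewrite divr_gt0.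
exists dl => // s Ts sd; rewrite scalerAr -!mulrBr normqM.
apply: le_trans (ler_wpM2l (normr_ge0 c) (H _ Ts sd)) _.
rewrite mulrA ler_wpM2r // mulrCA ler_piMr ?(ltW e0) // ler_pdivrMr // mul1r lerDl //.
Qed.

(** The two coordinates of xi_h(l) in the plane of [l] are integrated separately. The last clause
    has slope [l] = xi_0(l) even at right-scattered points, where it expresses continuity. *)
Lemma exists_cylinder_primitive l : T 0 -> exists F : R -> quat R,
  [/\ forall t, exists a b, F t = qplane (qunit l) a b,
      forall t, T t -> F (sigma T t) = F t + mu T t *: cylinder (mu T t) l
    & forall t e, T t -> 0 < e -> exists2 dl, 0 < dl & forall s, T s -> `|s - t| < dl ->
        `|F t - F s - (t - s) *: l| <= e * `|t - s| ].
Proof.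
move=> T0; have hu := qunitP l; set u := qunit l in hu *.
(* Coordinates are chosen for all [h] at once; for negative [h] they are arbitrary. *)
have [|C HC] := @choice _ _ (fun h (ab : R * R) => 0 <= h ->
    cylinder h l = qplane u ab.1 ab.2).
  move=> h; case: (leP 0 h) => h0; last by exists (0, 0).
  by have [ab E] := cylinder_qplane l h0; exists ab.
have l0 : l = qplane u (C 0).1 (C 0).2 by rewrite -HC // /cylinder eqxx.
have cv e : 0 < e -> exists2 dl, 0 < dl & forall h, 0 <= h < dl ->
    `|(C h).1 - (C 0).1| <= e /\ `|(C h).2 - (C 0).2| <= e.
  move=> e0; have [dl dl0 H] := cylinder_cvg0 l e0; exists dl => // h hd.
  have := H _ hd; rewrite HC; last by case/andP: hd.
  rewrite {1}l0 qplaneN qplaneD => Hn.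
  have [n1 n2] := norm_qplane_ge ((C h).1 - (C 0).1) ((C h).2 - (C 0).2) hu.
  by split; [exact: le_trans n1 Hn | exact: le_trans n2 Hn].
have cv1 e : 0 < e -> exists2 dl, 0 < dl & forall h, 0 <= h < dl ->
    `|(C h).1 - (C 0).1| <= e.
  by move/cv => [dl dl0 H]; exists dl => // h /H[].
have cv2 e : 0 < e -> exists2 dl, 0 < dl & forall h, 0 <= h < dl ->
    `|(C h).2 - (C 0).2| <= e.
  by move/cv => [dl dl0 H]; exists dl => // h /H[].
have [F1 [J1 D1]] := @exists_gap_primitive _ _ hT (fst \o C) cv1 T0.
have [F2 [J2 D2]] := @exists_gap_primitive _ _ hT (snd \o C) cv2 T0.
exists (fun t => qplane u (F1 t) (F2 t)); split.
- by move=> t; exists (F1 t), (F2 t).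
- by move=> t Tt; rewrite J1 // J2 // HC ?mu_ge0 // qplaneZ qplaneD.
move=> t e Tt e0; have e20 : 0 < e / 2 by rewrite divr_gt0.
have [d1 d10 H1] := D1 _ e20; have [d2 d20 H2] := D2 _ e20.
exists (Num.min d1 d2); first by rewrite lt_min d10.
move=> s Ts; rewrite lt_min => /andP[s1 s2].
rewrite {1}l0 qplaneZ !qplaneN !qplaneD; apply: le_trans (norm_qplane_le _ _ hu) _.
rewrite {1}[e]splitr (mulrDl (e / 2)).
(* The primitives come with estimates for [s <= t] only. As these are uniform in both points,
   exchanging [s] and [t] covers the other side. *)
have both (F : R -> R) k dl : 0 < dl -> (forall s t, T s -> T t -> s <= t < s + dl ->
    `|F t - F s - k * (t - s)| <= e / 2 * (t - s)) -> `|s - t| < dl ->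
    `|F t - F s - (t - s) * k| <= e / 2 * `|t - s|.
  move=> dl0 H; rewrite ltr_norml => /andP[sa sb]; case: (leP s t) => st.
    by rewrite (ger0_norm (_ : 0 <= t - s)) ?subr_ge0 // [_ * k]mulrC; apply: H => //; lra.
  rewrite (ltr0_norm (_ : t - s < 0)) ?subr_lt0 // opprB -normrN.
  have -> : - (F t - F s - (t - s) * k) = F s - F t - k * (s - t) by ring.
  by apply: H => //; lra.
by apply: lerD; [exact: both H1 s1 | exact: both H2 s2].
Qed.

Section ConstantExponent.
Variable l : quat R.
Hypothesis T0 : T 0.

(** The multiplicative rule holds because all values of [F] lie in one plane, so that the exponents
    commute. *)
Lemma delta_exp_primitive : exists F : R -> quat R,
  [/\ forall s t, T s -> T t -> delta_exp T l t 0 = qexp (F t - F s) * delta_exp T l s 0,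
      forall t, T t -> F (sigma T t) - F t = mu T t *: cylinder (mu T t) l
    & forall t e, T t -> 0 < e -> exists2 dl, 0 < dl & forall s, T s -> `|s - t| < dl ->
        `|F t - F s - (t - s) *: l| <= e * `|t - s| ].
Proof.
have [F [Fu FJ FD]] := exists_cylinder_primitive l T0; exists F; split=> //; last first.
  by move=> t Tt; rewrite FJ // addrC addKr.
have EF t : T t -> delta_exp T l t 0 = qexp (F t - F 0).
  move=> Tt; rewrite /delta_exp (@delta_integralE _ _ hT F) // => s ks.
  have Ts := kappa_sub ks; apply: (@is_delta_derivative_intro _ _ _ l) => //.
  - exact: FJ.
  - by move=> ->; rewrite /cylinder eqxx.
  - by move=> e e0; exact: FD.
move=> s t Ts Tt; rewrite !EF //.
have -> : F t - F 0 = (F t - F s) + (F s - F 0) by rewrite addrA subrK.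
have [a0 [b0 E0]] := Fu 0; have [a [b Es]] := Fu s; have [a' [b' Et]] := Fu t.
by rewrite E0 Es Et !qplaneN !qplaneD -qplaneD qexpD_qplane //; exact: qunitP.
Qed.

Lemma delta_exp00 : delta_exp T l 0 0 = 1.
Proof.
rewrite /delta_exp (_ : delta_integral _ _ _ _ = 0) ?qexp0 // /delta_integral.
by case: xgetP => // v -> [F [_ ->]]; rewrite subrr.
Qed.

(** At a jump, E is multiplied by exp(Ln(1 + mu l)) = 1 + mu l, where the logarithm needs
    regressivity. Near [t], E(s) = exp(z) E(t) with z = F(s) - F(t) close to (s - t) l. *)
Lemma is_delta_derivative_exp t : kappa T t -> 1 + mu T t *: l != 0 ->
  is_delta_derivative T (fun s => delta_exp T l s 0) t (l * delta_exp T l t 0).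
Proof.
move=> kt reg; have Tt := kappa_sub kt; have [F [EF FJ FD]] := delta_exp_primitive.
set E := delta_exp T l t 0.
apply: (@is_delta_derivative_intro _ _ _ (l * E)) => //.
  rewrite (EF t) //; last exact: sigma_in.
  rewrite FJ // scalerAl -[X in X + _]mul1r -mulrDl; congr (_ * _).
  rewrite /cylinder; case: eqVneq => [->|m0]; first by rewrite !scale0r addr0 qexp0.
  by rewrite scalerA mulfV // scale1r qexp_qLn.
(* Replacing exp(z) - 1 by z costs [r * (|l| + 1)], replacing z by (s - t) l costs [r], both
   relative to [|t - s|]; the sum is multiplied by [|E|]. *)
move=> e e0; pose K := (`|l| + 2) * (`|E| + 1).
have K0 : 0 < K by rewrite mulr_gt0 ?ltr_wpDl.
have [r r0 [r1 rK]] : exists2 r, 0 < r & r <= 1 /\ r <= e / K.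
  exists (Num.min 1 (e / K)); first by rewrite lt_min ltr01 divr_gt0.
  by split; rewrite ge_min lexx ?orbT.
have [d1 d10 H1] := FD _ _ Tt r0; have [d2 d20 H2] := qexp_approx r0.
have l1 : 0 < `|l| + 1 by rewrite ltr_wpDl.
exists (Num.min d1 (d2 / (`|l| + 1))); first by rewrite lt_min d10 divr_gt0.
move=> s Ts; rewrite lt_min ltr_pdivlMr // => /andP[s1 s2].
have {}H1 := H1 _ Ts s1; pose z := F s - F t.
have zl : `|z - (s - t) *: l| <= r * `|t - s|.
  by apply: le_trans H1; rewrite -normrN le_eqVlt; apply/orP; left; apply/eqP;
    congr `|_|; rewrite /z; apply: quatP => /=; ring.
have zle : `|z| <= (`|l| + 1) * `|t - s|.
  rewrite -[z](subrK ((s - t) *: l)); apply: le_trans (ler_normD _ _) _.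
  rewrite normrZ (distrC s) addrC mulrDl [`|l| * _]mulrC lerD2l.
  by apply: le_trans zl _; rewrite ler_wpM2r.
have {}H2 : `|qexp z - 1 - z| <= r * `|z|.
  by apply: H2; apply: le_lt_trans zle _; rewrite mulrC distrC.
rewrite (EF t s) // -/E -/z.
have split_err (x y p : quat R) : p - x * p - (t - s) *: (l * p) =
    - (((x - 1 - y) + (y - (s - t) *: l)) * p).
  by apply: quatP => /=; ring.
rewrite (split_err _ z).
rewrite normrN normqM.
have : `|(qexp z - 1 - z) + (z - (s - t) *: l)| <= r * (`|l| + 2) * `|t - s|.
  apply: le_trans (ler_normD _ _) _; apply: le_trans (lerD H2 zl) _.
  have : r * `|z| <= r * ((`|l| + 1) * `|t - s|) by rewrite ler_pM2l.
  lra.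
move=> H; apply: le_trans (ler_wpM2r (normr_ge0 E) H) _.
rewrite mulrAC ler_wpM2r //.
apply: (@le_trans _ _ (r * K)).
  by rewrite /K mulrA ler_wpM2l ?mulr_ge0 ?addr_ge0 ?(ltW r0) // lerDl.
by rewrite -ler_pdivlMr.
Qed.

End ConstantExponent.

Variables (n : nat) (A : 'M[quat R]_n).
Hypotheses (T0 : T 0) (hA : regressive T A).

(** If 1 + mu l vanished, the invertible matrix I + mu A would send the nonzero vector v to v (1 +
    mu l) = 0. *)
Lemma regressive_eigenvalue l (v : 'cV[quat R]_n) t :
  right_eigenvector A l v -> kappa T t -> 1 + mu T t *: l != 0.
Proof.
move=> [v0 Av] kt; have [B [_ BA]] := hA kt; apply/eqP => E; case/eqP: v0.
rewrite -[v]mul1mx -BA -mulmxA mulmxDl mul1mx -scalemxAl Av.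
rewrite (_ : v + _ = 0) ?mulmx0 //; apply/matrixP => i j; rewrite !mxE ord1.
rewrite (_ : _ * (_ * l) = v i 0 * (mu T t *: l)).
  by rewrite -[X in X + _]mulr1 -mulrDr E mulr0.
by apply: quatP => /=; ring.
Qed.

Lemma exp_eigen_matrix_fundamental (l : 'I_n -> quat R) (eta : 'I_n -> 'cV[quat R]_n) :
  (forall i, right_eigenvector A (l i) (eta i)) -> right_independent eta ->
  fundamental_solution_matrix T A (exp_eigen_matrix T l eta).
Proof.
move=> Aeta ieta; split=> [j t kt i|a H].
  have -> : (fun s => col j (exp_eigen_matrix T l eta s) i 0) =
            (fun s => eta j i 0 * delta_exp T (l j) s 0).
    by apply/funext => s; rewrite !mxE.
  have -> : col j (exp_eigen_matrix T l eta t) = rscale (eta j) (delta_exp T (l j) t 0).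
    by apply/matrixP => k m; rewrite !mxE.
  have [_ Aj] := Aeta j.
  have -> : (A *m rscale (eta j) (delta_exp T (l j) t 0)) i 0 =
            eta j i 0 * (l j * delta_exp T (l j) t 0).
    rewrite mulrA; move/matrixP/(_ i 0) : Aj; rewrite !mxE => <-; rewrite mulr_suml.
    by apply: eq_bigr => k _; rewrite !mxE mulrA.
  by apply/is_delta_derivativeMl/is_delta_derivative_exp; last exact: regressive_eigenvalue kt.
(* Independence needs the relation at [t = 0] only, where every exponential is 1. *)
apply: ieta; rewrite -[RHS](H 0 T0); apply: eq_bigr => j _.
by apply/matrixP => k m; rewrite !mxE delta_exp00 mulr1.
Qed.

End DeltaExponential.

(** * Right linear dependence over the quaternions, and the standard eigenvalues *)

Section StandardEigenvalues.
Variable R : realType.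
Implicit Types (l p q : quat R).

(** Gaussian elimination for [n] equations in [m] unknowns multiplied on the right, by induction on
    [n]. *)
Lemma quat_dependent n m (v : 'I_m -> 'I_n -> quat R) : (n < m)%N ->
  exists a : 'I_m -> quat R,
    (exists i, a i != 0) /\ forall j, \sum_i v i j * a i = 0.
Proof.
elim: n m v => [|n IH] [|m] // v nm.
  exists (fun=> 1); split; first by exists ord0; exact: oner_neq0.
  by case.
case: (pselect (exists k, v k ord0 != 0)) => [[k vk]|v0]; last first.
  have [|a [a0 Ha]] := IH m.+1 (fun i j => v i (lift ord0 j)); first exact: ltnW.
  exists a; split=> // j; case: (unliftP ord0 j) => [j' ->|->]; first exact: Ha.
  rewrite big1 // => i _; rewrite (_ : v i ord0 = 0) ?mul0r //.
  by apply/eqP/negPn/negP => vi; apply: v0; exists i.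
(* A left multiple of equation [ord0] is subtracted from each other equation to remove the unknown
   [a k], which is recovered from equation [ord0] afterwards. *)
pose w (i : 'I_m) (j : 'I_n) := v (lift k i) (lift ord0 j)
  - v k (lift ord0 j) * (v k ord0)^-1 * v (lift k i) ord0.
have [//|b [[i0 bi0] Hb]] := IH m w.
pose a i := if unlift k i is Some i' then b i'
  else - ((v k ord0)^-1 * \sum_i' v (lift k i') ord0 * b i').
have ak : a k = - ((v k ord0)^-1 * \sum_i' v (lift k i') ord0 * b i').
  by rewrite /a unlift_none.
have al i : a (lift k i) = b i by rewrite /a liftK.
exists a; split; first by exists (lift k i0); rewrite al.
move=> j; rewrite (bigD1_ord k) //= ak; under eq_bigr do rewrite al.
case: (unliftP ord0 j) => [j' ->|->]; last first.
  by rewrite mulrN mulrA mulrV ?mul1r ?addNr.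
rewrite -[RHS](Hb j') mulrN mulrA mulr_sumr addrC -sumrB.
by apply: eq_bigr => i _; rewrite /w mulrBl !mulrA.
Qed.

Variables (n : nat) (A : 'M[quat R]_n).

Lemma mulmx_rscale (v : 'cV[quat R]_n) p : A *m rscale v p = rscale (A *m v) p.
Proof.
apply/matrixP => i j; rewrite !mxE mulr_suml.
by apply: eq_bigr => k _; rewrite !mxE mulrA.
Qed.

Lemma rscaleA (v : 'cV[quat R]_n) p q : rscale (rscale v p) q = rscale v (p * q).
Proof. by apply/matrixP => i j; rewrite !mxE mulrA. Qed.

Lemma rscaleBr (v : 'cV[quat R]_n) p q : rscale v (p - q) = rscale v p - rscale v q.
Proof. by apply/matrixP => i j; rewrite !mxE mulrBr. Qed.

Lemma rscale0 (v : 'cV[quat R]_n) : rscale v 0 = 0.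
Proof. by apply/matrixP => i j; rewrite !mxE mulr0. Qed.

Lemma rscale1 (v : 'cV[quat R]_n) : rscale v 1 = v.
Proof. by apply/matrixP => i j; rewrite !mxE mulr1 ord1. Qed.

Lemma sum_rscale m (v : 'I_m -> 'cV[quat R]_n) q :
  rscale (\sum_i v i) q = \sum_i rscale (v i) q.
Proof.
apply/matrixP => i j; rewrite !mxE !summxE mulr_suml.
by apply: eq_bigr => k _; rewrite !mxE.
Qed.

(* If a is a shortest nontrivial relation and a_k <> 0, then applying [A] and
   subtracting the relation right multiplied by a_k^-1 l_k a_k gives a shorter
   one, hence a trivial one; so the l_i with a_i <> 0 are all similar to l_k. *)
Lemma nonsimilar_independent m (l : 'I_m -> quat R) (eta : 'I_m -> 'cV[quat R]_n) :
  (forall i, right_eigenvector A (l i) (eta i)) ->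
  (forall i j a, i != j -> l i * a = a * l j -> a = 0) ->
  right_independent eta.
Proof.
move=> Aeta nsim a; have [N] := ubnP #|[pred i | a i != 0]|.
elim: N a => // N IH a cardN Ha i.
apply/eqP/negPn/negP => ai; pose c := (a i)^-1 * l i * a i.
pose b j := l j * a j - a j * c.
have Hb : \sum_j rscale (eta j) (b j) = 0.
  under eq_bigr do rewrite /b rscaleBr -(rscaleA _ (l _)) -(rscaleA _ (a _) c).
  rewrite sumrB -(sum_rscale (fun j => rscale (eta j) (a j))) Ha.
  under eq_bigr do rewrite -(Aeta _).2 -mulmx_rscale.
  rewrite -mulmx_sumr Ha mulmx0 sub0r.
  by apply/matrixP => r s; rewrite !mxE mul0r oppr0.
have b0 j : b j = 0.
  apply: (IH b) => //; rewrite -ltnS; apply: leq_trans cardN; rewrite ltnS.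
  apply: proper_card; apply/properP; split.
    apply/fintype.subsetP => k; rewrite !inE; apply: contra => /eqP ak.
    by rewrite /b ak mulr0 mul0r subrr.
  exists i; rewrite !inE //= negbK /b /c !mulrA mulrV // mul1r subrr //.
have a0 j : j != i -> a j = 0.
  move=> ji; suff : a j * (a i)^-1 = 0.
    by move=> /(congr1 ( *%R^~ (a i))); rewrite mul0r -mulrA mulVr ?mulr1.
  apply: nsim ji _; have /eqP := b0 j; rewrite subr_eq0 /c => /eqP E.
  by rewrite mulrA E -!mulrA mulrV ?mulr1.
have [/eqP e0 _] := Aeta i; apply: e0; move: Ha.
rewrite (bigD1 i) //= big1 ?addr0 => [|j ji]; last by rewrite a0 ?rscale0.
move=> /(congr1 (fun v => rscale v (a i)^-1)); rewrite rscaleA mulrV // rscale1 => ->.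
by apply/matrixP => r s; rewrite !mxE mul0r.
Qed.

(** Write a = z1 + z2 j with complex z1, z2. Moving q past j conjugates it, so (l - q) z1 = 0 and (l
    - conj q) z2 = 0; [F1] to [F4] are these equations multiplied by the conjugates of z1 and z2. If
    z2 is nonzero, then l = conj q, and nonnegative imaginary parts make both real. *)
Lemma standard_similar_eq l q a :
  0 <= qi l -> qj l = 0 -> qk l = 0 -> 0 <= qi q -> qj q = 0 -> qk q = 0 ->
  a != 0 -> l * a = a * q -> l = q.
Proof.
case: l => x y ? ?; case: q => x' y' ? ?; case: a => p r s t /= y0 -> -> y'0 -> -> a0.
case; rewrite !(mul0r, mulr0, subr0, addr0) => E1 E2 E3 E4.
have F1 : (x - x') * (p ^+ 2 + r ^+ 2) = 0.
  transitivity (p * (x * p - y * r - (p * x' - r * y')) + r * (x * r + y * p - (p * y' + r * x'))).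
    by ring.
  by rewrite E1 E2 !subrr !mulr0 addr0.
have F2 : (y - y') * (p ^+ 2 + r ^+ 2) = 0.
  transitivity (p * (x * r + y * p - (p * y' + r * x')) - r * (x * p - y * r - (p * x' - r * y'))).
    by ring.
  by rewrite E1 E2 !subrr !mulr0 subr0.
have F3 : (x - x') * (s ^+ 2 + t ^+ 2) = 0.
  transitivity (s * (x * s - y * t - (s * x' + t * y')) + t * (x * t + y * s - (t * x' - s * y'))).
    by ring.
  by rewrite E3 E4; ring.
have F4 : (y + y') * (s ^+ 2 + t ^+ 2) = 0.
  transitivity (s * (x * t + y * s - (t * x' - s * y')) - t * (x * s - y * t - (s * x' + t * y'))).
    by ring.
  by rewrite E3 E4; ring.
case: (eqVneq (p ^+ 2 + r ^+ 2) 0) => [pr|pr].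
  case: (eqVneq (s ^+ 2 + t ^+ 2) 0) => [st|st].
    case/negP: a0; apply/eqP/sqnormq_eq0.
    by rewrite /sqnormq /= pr add0r st.
  move/eqP: F3; move/eqP: F4; rewrite !mulf_eq0 (negPf st) !orbF.
  move=> /eqP yy /eqP xx; apply: quatP => //=; lra.
move/eqP: F1; move/eqP: F2; rewrite !mulf_eq0 (negPf pr) !orbF.
by move=> /eqP yy /eqP xx; apply: quatP => //=; lra.
Qed.

Lemma standard_independent m (l : 'I_m -> quat R) : injective l ->
  (forall i, standard_eigenvalues A (l i)) ->
  exists eta : 'I_m -> 'cV[quat R]_n,
    (forall i, right_eigenvector A (l i) (eta i)) /\ right_independent eta.
Proof.
move=> linj lstd.
have [|eta Aeta] := @choice _ _ (fun i v => right_eigenvector A (l i) v).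
  by move=> i; have [] := lstd i.
exists eta; split=> //; apply: nonsimilar_independent Aeta _ => i j a ij E.
apply/eqP/negPn/negP => a0; case/eqP: ij; apply: linj.
have [_ [? ? ?]] := lstd i; have [_ [? ? ?]] := lstd j.
exact: standard_similar_eq E.
Qed.

Lemma standard_card m (l : 'I_m -> quat R) : injective l ->
  (forall i, standard_eigenvalues A (l i)) -> (m <= n)%N.
Proof.
move=> linj lstd; have [eta [_ ieta]] := standard_independent linj lstd.
rewrite leqNgt; apply/negP => nm.
have [a [[i ai] Ha]] := quat_dependent (fun i j => eta i j 0) nm.
case/eqP: ai; apply: ieta; apply/matrixP => r s; rewrite summxE ord1 mxE -[RHS](Ha r).
by apply: eq_bigr => k _; rewrite !mxE.
Qed.

(** A standard eigenvalue outside the range would extend [l] to [n.+1] distinct ones, against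
    [standard_card]. *)
Lemma standard_range (l : 'I_n -> quat R) : injective l ->
  (forall i, standard_eigenvalues A (l i)) -> range l = standard_eigenvalues A.
Proof.
move=> linj lstd; apply/seteqP; split=> [_ [i _ <-] //|q sq].
apply: contrapT => nq.
pose l' i := if unlift (@ord0 n) i is Some i' then l i' else q.
have l'0 : l' ord0 = q by rewrite /l' unlift_none.
have l'S i : l' (lift ord0 i) = l i by rewrite /l' liftK.
suff : (n < n)%N by rewrite ltnn.
apply: (@standard_card n.+1 l') => [i j|i].
  case: (unliftP ord0 i) => [i' ->|->]; case: (unliftP ord0 j) => [j' ->|->] //;
    rewrite ?l'0 ?l'S => E.
  - by rewrite (linj _ _ E).
  - by case: nq; exists i'.
  - by case: nq; exists j'.
by case: (unliftP ord0 i) => [i' ->|->]; rewrite ?l'0 ?l'S.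
Qed.

End StandardEigenvalues.

Theorem theorem5p2 (R : realType) (T : set R) (n : nat) (A : 'M[quat R]_n)
    (hT : time_scale T) (h0 : T 0) (hA : regressive T A) :
  (forall (lambda : 'I_n -> quat R) (eta : 'I_n -> 'cV[quat R]_n),
     (forall i, right_eigenvector A (lambda i) (eta i)) ->
     right_independent eta ->
     fundamental_solution_matrix T A (exp_eigen_matrix T lambda eta)) /\
  (forall lambda : 'I_n -> quat R,
     injective lambda -> (forall i, standard_eigenvalues A (lambda i)) ->
     range lambda = standard_eigenvalues A /\
     exists eta : 'I_n -> 'cV[quat R]_n,
       [/\ forall i, right_eigenvector A (lambda i) (eta i),
           right_independent eta &
           fundamental_solution_matrix T A (exp_eigen_matrix T lambda eta)]).
Proof.
split=> [lambda eta|lambda linj lstd]; first exact: exp_eigen_matrix_fundamental.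
split; first exact: standard_range.
have [eta [Aeta ieta]] := standard_independent linj lstd.
by exists eta; split=> //; exact: exp_eigen_matrix_fundamental.
Qed.
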